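(* Let $H\in(0,1)$, $K\in(0,1]$ and let $B^{H,K}_0$ be a bifractional Brownian motion in $\mathbb{R}$ with indices $H$ and $K$. For all constants $0<a<b$, $B_0^{H,K}$ is strongly locally $\varphi$-nondeterministic on $I=[a,b]$ with $\varphi(r)=r^{2HK}$; that is, there exist positive constants $c$ and $r_0$ such that for all $t\in I$ and all $0<r\le\min\{t,r_0\}$, $$\mathrm{Var}\Big(B_0^{H,K}(t)\,\Big|\,B_0^{H,K}(s):\ s\in I,\ r\le|s-t|\le r_0\Big)\ge c\,\varphi(r).$$
   Context: For $H\in(0,1)$ and $K\in(0,1]$, the bifractional Brownian motion in $\mathbb{R}$ with indices $H,K$ is the centered Gaussian process $B^{H,K}_0=\{B^{H,K}_0(t),\,t\in\mathbb{R}_+\}$ with $B^{H,K}_0(0)=0$ and covariance function $$\mathbb{E}\big[B^{H,K}_0(s)B^{H,K}_0(t)\big]=\frac{1}{2^K}\Big[(t^{2H}+s^{2H})^K-|t-s|^{2HK}\Big].$$ $\mathrm{Var}(X\mid Z_s:s\in S)$ denotes the conditional variance of the Gaussian variable $X$ given the $\sigma$-algebra generated by the jointly Gaussian family $(Z_s)_{s\in S}$ (a deterministic number, equal to the squared $L^2$-distance from $X$ to the closed linear span of the $Z_s$ in the centered case). *)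

(* Defs.v *)
From HB Require Import structures.
From mathcomp Require Import all_boot all_order all_algebra.
From mathcomp Require Import all_classical all_reals all_analysis.
Set Implicit Arguments.
Unset Strict Implicit.
Unset Printing Implicit Defensive.
Import Order.TTheory GRing.Theory Num.Theory.
Import numFieldNormedType.Exports.
Local Open Scope classical_set_scope.
Local Open Scope ring_scope.

Section conditioning.
Context (d : measure_display) (T : measurableType d) (R : realType).
Variable P : probability T R.

Definition sigma_family (J : Type) (S : set J) (Z : J -> T -> R) : set (set T) :=
  <<s \bigcup_(s in S) preimage_set_system setT (Z s) measurable >>.

(* [Y] is a version of E[X | G]; [G] is meant to be a sub-sigma-algebra. *)
Definition is_cond_exp (G : set (set T)) (X Y : T -> R) : Prop :=
  [/\ preimage_set_system setT Y measurable `<=` G,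
      P.-integrable setT (EFin \o Y) &
      forall A, G A ->
        (\int[P]_(x in A) (Y x)%:E = \int[P]_(x in A) (X x)%:E)%E].

(* Versions are unique up to P-negligible sets and exist for integrable [X];
   when there is none, [cond_exp] is the constant 0 by convention, so it is
   meaningful only for integrable [X] and only up to almost sure equality. *)
Definition cond_exp (G : set (set T)) (X : T -> R) : T -> R :=
  xget (cst 0) [set Y | is_cond_exp G X Y].

Definition cond_var (G : set (set T)) (X : T -> R) : T -> R :=
  cond_exp G (fun w => (X w - cond_exp G X w) ^+ 2).

End conditioning.

Section gaussian.
Context (d : measure_display) (T : measurableType d) (R : realType).
Variable P : probability T R.

(* Constants count as Gaussian. They need a separate clause because
   [normal_prob m 0] is the uniform law on [0, 1], not the Dirac mass at [m]. *)
Definition gaussian_rv (X : T -> R) : Prop :=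
  exists m sigma : R, forall A : set R, measurable A ->
    pushforward P X A =
      if sigma == 0 then \d_m A else normal_prob m sigma A.

Definition gaussian_process (D : set R) (X : R -> T -> R) : Prop :=
  forall (n : nat) (t u : 'I_n -> R), (forall i, D (t i)) ->
    gaussian_rv (fun w => \sum_(i < n) u i * X (t i) w).

(* The time set is [0, +oo[; the variables [B t] with [t < 0] are irrelevant. *)
Definition bifractional_brownian_motion
    (H K : R) (B : R -> {RV P >-> R}) : Prop :=
  [/\ gaussian_process [set t | 0 <= t] (fun t => B t),
      forall t, 0 <= t -> ('E_P[B t] = 0)%E,
      {ae P, forall w, B 0 w = 0} &
      forall s t, 0 <= s -> 0 <= t ->
        ('E_P[fun w => (B s w * B t w)%R] =
         ((2 `^ K)^-1 * ((t `^ (2 * H) + s `^ (2 * H)) `^ K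
                         - `|t - s| `^ (2 * H * K)))%:E)%E].

Definition strongly_locally_nondeterministic
    (X : R -> T -> R) (I : set R) (phi : R -> R) : Prop :=
  exists c r0 : R, [/\ 0 < c, 0 < r0 &
    forall t r : R, I t -> 0 < r <= Num.min t r0 ->
      {ae P, forall w, c * phi r <=
        cond_var P (sigma_family [set s | I s /\ r <= `|s - t| <= r0] X)
                 (X t) w}].

End gaussian.

(* Main.v *)
(** The covariance is compared with a positive semidefinite kernel that does not
    see the conditioning times. Put [b = 2H], let [kap] be a positive
    semidefinite function supported in [-1 <= h <= 1], and write [C |h|^b] as the
    Mellin integral over [v] of [kap 0 - kap (h e^-v)] against [e^(b v)]. With
    [V h] the part over [v <= ln r] of the same integral of [kap (h e^-v)], one
    has [V 0 >= c r^b] and [V h = 0] for [|h| >= r], while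
    [C s^b + C t^b - C |s - t|^b - V (s - t)] is still positive semidefinite at
    points [s, t >= r]. The power [x^K], a mixture of the functions
    [1 - e^(-x u)], preserves both comparisons in
      [C s^b + C t^b >= C |s - t|^b + V (s - t) >= C |s - t|^b],
    so the covariance of [B] dominates [((C |s - t|^b + V (s - t))^K - (C |s - t|^b)^K)],
    up to a constant factor. This kernel vanishes for [|s - t| >= r], hence
    every linear prediction of [B t] from times at distance at least [r] has mean
    square error at least [c r^(2HK)].

    The residual of the best linear prediction is Gaussian and uncorrelated with
    the observations, hence independent of them, so the conditional variance
    is almost surely the constant mean square error. Independence is obtained
    from the joint characteristic function, tested on [cos] and [sin]. *)

Require Import Defs.
From HB Require Import structures.
From mathcomp Require Import all_boot all_order all_algebra.
From mathcomp Require Import all_classical all_reals all_analysis.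
From mathcomp Require Import measurable_realfun ring lra.
Import Order.TTheory GRing.Theory Num.Theory.
Import numFieldNormedType.Exports.
Local Open Scope classical_set_scope.
Local Open Scope ring_scope.
Set Implicit Arguments.
Unset Strict Implicit.
Unset Printing Implicit Defensive.

(** * Positive semidefinite kernels *)

(** A prediction error is the covariance form at a vector whose coefficient at the predicted time is
    [1]. If a dominating kernel has no entry between that time and the others, the form is at least
    its diagonal entry, whatever the number, position or repetition of the observed times. The
    constant is therefore uniform over finite combinations and survives the passage to an infinite
    family of observations.

    The origin behaves like one more observation, since [C s^b + C t^b - C |s - t|^b] is a Gram
    kernel of increments from [0]; this is why all times must be at least [r], and why [r0 = a] is
    chosen at the end.

    The obstacle is the power [K]: positivity of a difference passes to the difference of the powers
    only when [e^(-u A)] is positive semidefinite for the larger kernel [A]. The chain of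
    comparisons starts at the additive kernel because there this is immediate, and each lower kernel
    inherits it through a Schur product. *)

Definition psd (R : realType) (I : finType) (k : I -> I -> R) : Prop :=
  (forall i j, k i j = k j i) /\
  forall u : I -> R, 0 <= \sum_i \sum_j u i * u j * k i j.

Section psd_theory.
Context {R : realType} {I : finType}.
Implicit Types (k : I -> I -> R) (u : I -> R).

Lemma eq_psd k1 k2 : (forall i j, k1 i j = k2 i j) -> psd k1 -> psd k2.
Proof. by move=> e; rewrite (_ : k1 = k2)//; apply/funext => i; apply/funext => j. Qed.

Lemma psdD k1 k2 : psd k1 -> psd k2 -> psd (fun i j => k1 i j + k2 i j).
Proof.
move=> [s1 p1] [s2 p2]; split=> [i j|u]; first by rewrite s1 s2.
rewrite [leRHS](_ : _ = \sum_i \sum_j u i * u j * k1 i j +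
   \sum_i \sum_j u i * u j * k2 i j) ?addr_ge0//.
rewrite -big_split; apply: eq_bigr => i _; rewrite -big_split /=.
by apply: eq_bigr => j _; rewrite mulrDr.
Qed.

Lemma psdZ c k : 0 <= c -> psd k -> psd (fun i j => c * k i j).
Proof.
move=> c0 [s p]; split=> [i j|u]; first by rewrite s.
rewrite [leRHS](_ : _ = c * \sum_i \sum_j u i * u j * k i j) ?mulr_ge0//.
rewrite mulr_sumr; apply: eq_bigr => i _; rewrite mulr_sumr.
by apply: eq_bigr => j _; rewrite mulrCA.
Qed.

Lemma psd_congr u k : psd k -> psd (fun i j => u i * u j * k i j).
Proof.
move=> [s p]; split=> [i j|v]; first by rewrite s [u i * _]mulrC.
rewrite [leRHS](_ : _ = \sum_i \sum_j (v i * u i) * (v j * u j) * k i j)//.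
by apply: eq_bigr => i _; apply: eq_bigr => j _; rewrite mulrA mulrACA.
Qed.

Lemma psd_rank1 u : psd (fun i j => u i * u j).
Proof.
split=> [i j|v]; first by rewrite mulrC.
rewrite [leRHS](_ : _ = (\sum_i v i * u i) ^+ 2) ?sqr_ge0//.
rewrite expr2 mulr_suml; apply: eq_bigr => i _; rewrite mulr_sumr.
by apply: eq_bigr => j _; rewrite mulrACA.
Qed.

Lemma psd_cst (c : R) : 0 <= c -> psd (fun _ _ : I => c).
Proof.
move=> c0; apply: eq_psd (psdZ c0 (psd_rank1 (fun _ : I => 1 : R))) => i j.
by rewrite !mulr1.
Qed.

Lemma psd_sum (fs : seq (I -> R)) k : psd k ->
  psd (fun i j => \sum_(f <- fs) f i * f j * k i j).
Proof.
move=> pk; elim: fs => [|f fs ih].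
  by apply: (@eq_psd (fun _ _ => 0)) (psd_cst (lexx 0)) => i j; rewrite big_nil.
by apply: eq_psd (psdD (psd_congr f pk) ih) => i j; rewrite big_cons.
Qed.

Lemma psd_cvg (kn : nat -> I -> I -> R) k : (forall n, psd (kn n)) ->
  (forall i j, kn n i j @[n --> \oo] --> k i j) -> psd k.
Proof.
move=> pn cn; split=> [i j|u].
  apply: (@cvg_unique _ (@Rhausdorff R) _ _ _ _ (cn i j)).
  by have := cn j i; under eq_fun do rewrite (pn _).1.
have : (\sum_i \sum_j u i * u j * kn n i j) @[n --> \oo] -->
   \sum_i \sum_j u i * u j * k i j.
  apply: cvg_big => [|i _]; first exact: add_continuous.
  apply: cvg_big => [|j _]; first exact: add_continuous.
  by apply: cvgM; [exact: cvg_cst|exact: cn].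
move=> /cvgr_to_ge; apply.
by apply: nearW => n; exact: (pn n).2.
Qed.

(** Suitable [u] and [c] give the sign of the diagonal, the vanishing of rows with zero diagonal,
    the Schur complement and the prediction bound [psd_form_ge]. *)
Lemma psd_form_shift k u (c : R) i0 : (forall i j, k i j = k j i) ->
  \sum_i \sum_j (u i + c * (i == i0)%:R) * (u j + c * (j == i0)%:R) * k i j =
  \sum_i \sum_j u i * u j * k i j + 2 * c * (\sum_j u j * k i0 j) +
    c ^+ 2 * k i0 i0.
Proof.
move=> s.
have dl (F : I -> R) : \sum_i (i == i0)%:R * F i = F i0.
  rewrite (bigD1 i0)//= eqxx mul1r big1 ?addr0// => i /negbTE ->.
  by rewrite mul0r.
have e1 i : \sum_j (u i + c * (i == i0)%:R) * (u j + c * (j == i0)%:R) * k i j =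
  \sum_j u i * u j * k i j + c * (u i * k i i0) +
  c * ((i == i0)%:R * (\sum_j u j * k i j + c * k i i0)).
  rewrite (eq_bigr (fun j => u i * u j * k i j +
     (c * (i == i0)%:R) * (u j * k i j) +
     (j == i0)%:R * ((u i + c * (i == i0)%:R) * c * k i j))); last first.
    by move=> j _; ring.
  rewrite !big_split /= dl -mulr_sumr; ring.
rewrite (eq_bigr _ (fun i _ => e1 i)) !big_split /= -!mulr_sumr dl.
rewrite (_ : \sum_i u i * k i i0 = \sum_j u j * k i0 j); first by ring.
by apply: eq_bigr => j _; rewrite s.
Qed.

Lemma psd_diag_ge0 k i : psd k -> 0 <= k i i.
Proof.
move=> [s p]; have := p (fun j => 0 + 1 * (j == i)%:R).
rewrite psd_form_shift// [X in _ <= _ + X + _](_ : _ = 0); last first.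
  by rewrite big1 ?mulr0// => j _; rewrite mul0r.
rewrite big1 ?add0r ?expr1n ?mul1r ?addr0 ?add0r// => j _.
by rewrite big1// => l _; rewrite !mul0r.
Qed.

Lemma psd_diag0 k i j : psd k -> k i i = 0 -> k i j = 0.
Proof.
move=> [s p] k0; apply/eqP/negP => /negP kn0.
(* With a zero diagonal entry at [i], the form at [e_j + c e_i] is affine in [c]; this [c] makes it
   [-1]. *)
pose c := - (k j j + 1) / (2 * k i j).
pose v := fun l : I => 0 + 1 * (l == j)%:R : R.
have e (F : I -> R) : \sum_l v l * F l = F j.
  rewrite (bigD1 j)//= /v eqxx add0r !mul1r big1 ?addr0// => l /negbTE ->.
  by rewrite mulr0 addr0 mul0r.
have := p (fun l => v l + c * (l == i)%:R).
rewrite psd_form_shift// k0 e.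
rewrite (eq_bigr (fun l => v l * k l j)); last first.
  move=> l _; rewrite -(e (fun m => v l * k l m)); apply: eq_bigr => m _; ring.
rewrite e mulr0 addr0 (_ : 2 * c * k i j = - (k j j + 1)); first by lra.
by rewrite /c; field.
Qed.

(** Its form at [u] is the form of [k] at [u] with coordinate [i0] moved by the minimizing amount
    [- L / k i0 i0]. *)
Lemma psd_schur_complement k i0 : psd k -> 0 < k i0 i0 ->
  psd (fun i j => k i j - k i i0 * k i0 j / k i0 i0).
Proof.
move=> [s p] k0; split=> [i j|u].
  by rewrite s (s i i0) (s i0 j) [k i0 i * _]mulrC.
set L := \sum_j u j * k i0 j.
have := p (fun i => u i + (- L / k i0 i0) * (i == i0)%:R).
rewrite psd_form_shift// -/L => h.
rewrite [leRHS](_ : _ = \sum_i \sum_j u i * u j * k i j - L * L / k i0 i0).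
  apply: le_trans h _; rewrite le_eqVlt; apply/orP; left; apply/eqP.
  by field; rewrite gt_eqF.
rewrite (_ : L * L / _ = \sum_i \sum_j u i * u j * (k i i0 * k i0 j / k i0 i0)).
  rewrite -sumrB; apply: eq_bigr => i _; rewrite -sumrB; apply: eq_bigr => j _.
  by rewrite mulrBr.
rewrite {1}/L !mulr_suml; apply: eq_bigr => i _.
rewrite /L mulr_sumr mulr_suml; apply: eq_bigr => j _; rewrite (s i i0); ring.
Qed.

(** Cholesky factorization, by induction on the number of nonzero diagonal entries: the Schur
    complement at [i0] clears that entry and, by [psd_diag0], creates no new one. It serves to prove
    the Schur product theorem [psdM]. *)
Lemma psd_gram k : psd k ->
  exists fs : seq (I -> R), forall i j, k i j = \sum_(f <- fs) f i * f j.
Proof.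
have [n] := ubnP #|[set i | k i i != 0]%SET|; elim: n => // n ih in k *.
move=> lek pk.
have [/eqP h0|/set0Pn[i0]] := boolP ([set i | k i i != 0]%SET == finset.set0).
  exists [::] => i j; rewrite big_nil (@psd_diag0 k)//.
  by have := finset.in_set0 i; rewrite -h0 inE => /negbFE/eqP.
rewrite inE => ki0.
have k0 : 0 < k i0 i0 by rewrite lt_def ki0 psd_diag_ge0.
have pk' := psd_schur_complement pk k0.
have [|fs hfs] := ih _ _ pk'.
  rewrite -ltnS; apply: leq_trans lek; rewrite ltnS.
  apply: proper_card; apply/properP; split.
    apply/fintype.subsetP => i; rewrite !inE; apply: contraNneq => ki.
    by rewrite ki (psd_diag0 i0 pk ki) !mul0r subr0.
  by exists i0; rewrite inE ?mulfK ?subrr ?eqxx.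
exists ((fun i => k i i0 / Num.sqrt (k i0 i0)) :: fs) => i j.
rewrite big_cons -hfs (pk.1 j i0).
have -> : k i i0 / Num.sqrt (k i0 i0) * (k i0 j / Num.sqrt (k i0 i0)) =
    k i i0 * k i0 j / k i0 i0.
  by rewrite mulrACA -invfM -expr2 sqr_sqrtr// ltW.
by rewrite addrC subrK.
Qed.

Lemma psdM k1 k2 : psd k1 -> psd k2 -> psd (fun i j => k1 i j * k2 i j).
Proof.
move=> /psd_gram[fs e] /(psd_sum fs); apply: eq_psd => i j.
by rewrite e mulr_suml.
Qed.

Lemma psdX k n : psd k -> psd (fun i j => k i j ^+ n).
Proof.
move=> pk; elim: n => [|n ih]; first by apply: eq_psd (psd_cst ler01).
by apply: eq_psd (psdM pk ih) => i j; rewrite exprS.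
Qed.

(** The exponential series without its constant term is a limit of positive combinations of Schur
    powers. This form, stronger than [psd_expR], is the one that [psd_powRB] uses. *)
Lemma psd_expRB1 k : psd k -> psd (fun i j => expR (k i j) - 1).
Proof.
move=> pk; apply: (@psd_cvg (fun n i j => series (exp_coeff (k i j)) n.+1 - 1)).
  elim=> [|n ih].
    apply: eq_psd (psd_cst (lexx 0)) => i j.
    by rewrite /series/= big_nat1 /exp_coeff/= expr0 fact0 divr1 subrr.
  have pn : psd (fun i j => n.+1`!%:R^-1 * k i j ^+ n.+1).
    by apply: psdZ; [rewrite invr_ge0|exact: psdX].
  apply: eq_psd (psdD ih pn) => i j.
  by rewrite [in RHS]/series/= big_nat_recr//= /exp_coeff/= mulrC addrAC.
move=> i j; apply: cvgB; last exact: cvg_cst.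
by rewrite (cvg_shiftS (series (exp_coeff (k i j)))); exact: is_cvg_series_exp_coeff.
Qed.

Lemma psd_expR k : psd k -> psd (fun i j => expR (k i j)).
Proof.
move=> pk; apply: eq_psd (psdD (psd_expRB1 pk) (psd_cst ler01)) => i j.
by rewrite subrK.
Qed.

End psd_theory.

(** * Integration of real-valued functions *)

Section Rintegrable_theory.
Context d (T : measurableType d) (R : realType) (mu : {measure set T -> \bar R}).
Variables (D : set T) (mD : measurable D).
Implicit Types f g : T -> R.

Lemma integrableRD f g : mu.-integrable D (EFin \o f) ->
  mu.-integrable D (EFin \o g) -> mu.-integrable D (EFin \o (fun x => f x + g x)).
Proof. by move=> fi gi; exact: (integrableD mD fi gi). Qed.

Lemma integrableRB f g : mu.-integrable D (EFin \o f) ->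
  mu.-integrable D (EFin \o g) -> mu.-integrable D (EFin \o (fun x => f x - g x)).
Proof. by move=> fi gi; exact: (integrableB mD fi gi). Qed.

Lemma integrableRZ (c : R) f : mu.-integrable D (EFin \o f) ->
  mu.-integrable D (EFin \o (fun x => c * f x)).
Proof. by move=> fi; exact: (integrableZl mD c fi). Qed.

Lemma integrableR_sum (I : Type) (s : seq I) (h : I -> T -> R) :
  (forall i, mu.-integrable D (EFin \o h i)) ->
  mu.-integrable D (EFin \o (fun x => \sum_(i <- s) h i x)).
Proof.
move=> ih; elim: s => [|i s IH].
  by apply: eq_integrable (integrable0 _ _) => // x _ /=; rewrite big_nil.
by apply: eq_integrable (integrableRD (ih i) IH) => // x _ /=; rewrite big_cons.
Qed.

Lemma Rintegral_sum (I : Type) (s : seq I) (h : I -> T -> R) :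
  (forall i, mu.-integrable D (EFin \o h i)) ->
  \int[mu]_(x in D) (\sum_(i <- s) h i x) = \sum_(i <- s) \int[mu]_(x in D) h i x.
Proof.
move=> ih; elim: s => [|i s IH].
  rewrite big_nil (_ : (fun=> _) = fun=> 0) ?Rintegral_cst ?mul0r//.
  by apply/funext => x; rewrite big_nil.
rewrite big_cons -IH -RintegralD//; last exact: integrableR_sum.
by apply: eq_Rintegral => x _; rewrite big_cons.
Qed.

Lemma le_integrableR f g : measurable_fun D f -> (forall x, D x -> `|f x| <= g x) ->
  mu.-integrable D (EFin \o g) -> mu.-integrable D (EFin \o f).
Proof.
move=> mf fg; apply: le_integrable => //; first exact/measurable_EFinP.
by move=> x Dx /=; rewrite lee_fin (le_trans (fg x Dx))// ler_norm.
Qed.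

End Rintegrable_theory.

(** * Translation and reflection of Lebesgue integrals *)

Section measure_preserving.
Context {R : realType}.
Local Notation mu := (@lebesgue_measure R).

Lemma lebesgue_measure_shift (s : R) (A : set R) : measurable A ->
  pushforward mu ((fun x => x + s) : _ -> measurableTypeR R) A = mu A.
Proof.
move=> mA; have ms : @measurable_fun _ _ (measurableTypeR R) (measurableTypeR R)
    setT (fun x => x + s) by exact: measurable_funD.
pose f : {mfun measurableTypeR R >-> measurableTypeR R} :=
  HB.pack ((fun x => x + s) : measurableTypeR R -> measurableTypeR R)
    (isMeasurableFun.Build _ _ _ _ _ ms).
apply/esym/(@lebesgue_measure_unique _ (pushforward mu f)) => // _ [[a b]] _ <-.
have e : pushforward mu f `]a, b]%classic = mu `]a - s, b - s]%classic.
  by congr (mu _); apply/seteqP; split=> x /=; rewrite !in_itv/= lerBrDr ltrBlDr.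
by rewrite [RHS]e !lebesgue_measure_itv/= !lte_fin ltrD2r -!EFinB opprB addrA subrK.
Qed.

Lemma integrable_measure_preserving (phi : R -> R) (f : R -> R) :
  @measurable_fun _ _ (measurableTypeR R) (measurableTypeR R) setT phi ->
  (forall A, measurable A ->
     pushforward mu (phi : _ -> measurableTypeR R) A = mu A) ->
  mu.-integrable setT (EFin \o f) -> mu.-integrable setT (EFin \o (f \o phi)).
Proof.
move=> mphi pphi /integrableP[mf fi]; apply/integrableP; split.
  exact: (measurableT_comp mf mphi).
rewrite (_ : integral _ _ _ = (\int[mu]_x `|(f x)%:E|)%E)//.
have h := @ge0_integral_pushforward _ _ (measurableTypeR R) (measurableTypeR R) R phi mphi mu setT
  (fun x => `|(f x)%:E|)%E measurableT.
rewrite preimage_setT in h; rewrite -h//; last exact: measurableT_comp.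
by apply: eq_measure_integral => A mA _; exact: pphi.
Qed.

Lemma Rintegral_measure_preserving (phi : R -> R) (f : R -> R) :
  @measurable_fun _ _ (measurableTypeR R) (measurableTypeR R) setT phi ->
  (forall A, measurable A ->
     pushforward mu (phi : _ -> measurableTypeR R) A = mu A) ->
  mu.-integrable setT (EFin \o f) ->
  \int[mu]_x f (phi x) = \int[mu]_x f x.
Proof.
move=> mphi pphi fi; have fpi := integrable_measure_preserving mphi pphi fi.
congr fine; have /integrableP[mf _] := fi.
have h := @integral_pushforward _ _ (measurableTypeR R) (measurableTypeR R) R phi mphi mu setT
  (EFin \o f) mf.
rewrite preimage_setT in h; rewrite -[LHS]h//.
by apply: eq_measure_integral => A mA _; exact: pphi.
Qed.

Lemma integrable_shift (s : R) (f : R -> R) :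
  mu.-integrable setT (EFin \o f) ->
  mu.-integrable setT (EFin \o (fun x => f (x + s))).
Proof.
apply: (@integrable_measure_preserving (fun x => x + s)).
  exact: measurable_funD.
exact: lebesgue_measure_shift.
Qed.

Lemma Rintegral_shift (s : R) (f : R -> R) :
  mu.-integrable setT (EFin \o f) -> \int[mu]_x f (x + s) = \int[mu]_x f x.
Proof.
apply: (@Rintegral_measure_preserving (fun x => x + s)).
  exact: measurable_funD.
exact: lebesgue_measure_shift.
Qed.

(** Provides the dominating functions of the Mellin integrals; it lies below [c^-1] times the sum of
    the exponential density and its reflection. *)
Lemma integrable_expRNnorm (c : R) : 0 < c ->
  mu.-integrable setT (EFin \o (fun x => expR (- c * `|x|))).
Proof.
move=> c0; have ie := @integrable_exponential_pdf R c c0.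
have ie' : mu.-integrable setT (EFin \o (fun x => exponential_pdf c (- x))).
  apply: (@integrable_measure_preserving -%R) => //; exact: lebesgue_measureN.
apply: (@le_integrableR _ _ _ mu setT measurableT _ (fun x => c^-1 * (exponential_pdf c x + exponential_pdf c (- x)))) => //.
- apply: measurableT_comp => //; apply: measurable_funM => //; exact: measurableT_comp.
- move=> x _; rewrite ger0_norm ?expR_ge0//; have [x0|x0] := leP 0 x.
    rewrite mulrDr exponential_pdfE//= (ger0_norm x0) mulKf ?gt_eqF//.
    by rewrite lerDl mulr_ge0 ?exponential_pdf_ge0 ?invr_ge0 ?(ltW c0).
  rewrite mulrDr (exponential_pdfE _ (x := - x)) ?oppr_ge0 ?(ltW x0)//=.
  rewrite mulKf ?gt_eqF// ltr0_norm//.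
  by rewrite lerDr mulr_ge0 ?exponential_pdf_ge0 ?invr_ge0 ?(ltW c0).
- by apply: integrableRZ => //; exact: integrableRD.
Qed.

Lemma Rintegral_cst_itv (c a b : R) : a <= b ->
  \int[mu]_x (c * \1_(`[a, b]%classic) x) = c * (b - a).
Proof.
move=> ab; rewrite RintegralZl//; last exact: integrable_indic_itv.
congr (_ * _); rewrite /Rintegral integral_indic// setIT.
apply: (eq_trans (congr1 fine (@lebesgue_measure_itv R `[a, b]))).
rewrite /= lte_fin; case: ltP => // ba.
by rewrite (@le_anti _ _ a b) ?ab// subrr.
Qed.

End measure_preserving.

(** * A compactly supported positive semidefinite function *)

Lemma psd_Rintegral d (T : measurableType d) (R : realType)
    (mu : {measure set T -> \bar R}) (D : set T) (I : finType) (k : T -> I -> I -> R) :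
  measurable D -> (forall v, D v -> psd (k v)) ->
  (forall i j, mu.-integrable D (EFin \o (fun v => k v i j))) ->
  psd (fun i j => \int[mu]_(v in D) k v i j).
Proof.
move=> mD pk ik; split=> [i j|u].
  by apply: eq_Rintegral => v /set_mem Dv; exact: (pk v Dv).1.
rewrite [leRHS](_ : _ = \int[mu]_(v in D) \sum_i \sum_j u i * u j * k v i j).
  by apply: Rintegral_ge0 => v Dv; exact: (pk v Dv).2.
have ik' i j : mu.-integrable D (EFin \o (fun v => u i * u j * k v i j)).
  by apply: integrableRZ.
rewrite Rintegral_sum//; last by move=> i; apply: integrableR_sum.
apply: eq_bigr => i _; rewrite Rintegral_sum//.
by apply: eq_bigr => j _; rewrite RintegralZl.
Qed.

Section tent_autocorrelation.
Context {R : realType}.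
Local Notation mu := (@lebesgue_measure R).
Implicit Types x y w h : R.

(** A Lipschitz bump rather than an indicator: the autocorrelation of an interval leaves its maximum
    linearly, which would confine the Mellin integral to [b < 1]. For the tent the departure is
    quadratic, which covers all [b < 2]. *)
Definition tent w : R := Num.max 0 (2^-1 - `|w|).

Lemma tent_ge0 w : 0 <= tent w.
Proof. by rewrite le_max lexx. Qed.

Lemma tent_le w : tent w <= 2^-1.
Proof. by rewrite ge_max gerBl normr_ge0 invr_ge0 ler0n. Qed.

Lemma tent_out w : 2^-1 <= `|w| -> tent w = 0.
Proof. by move=> w1; apply/max_idPl; rewrite subr_le0. Qed.

Lemma tent_lip x y : `|tent x - tent y| <= `|x - y|.
Proof.
have := ler_dist_dist x y; rewrite ler_norml => /andP[xy yx].
rewrite /tent !maxEle; do 2 case: ifPn => ?; rewrite ler_norml; lra.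
Qed.

Lemma measurable_tent : measurable_fun setT tent.
Proof.
by apply: measurable_maxr => //; apply: measurable_funB => //.
Qed.

Lemma integrable_tentM (f : R -> R) (c : R) : measurable_fun setT f ->
  (forall w, `|f w| <= c) -> mu.-integrable setT (EFin \o (fun w => tent w * f w)).
Proof.
move=> mf fc; apply: (@le_integrableR _ _ _ mu setT measurableT _
  (fun w => c * \1_(`[-2^-1, 2^-1]%classic) w)).
- by apply: measurable_funM => //; exact: measurable_tent.
- move=> w _; have [w1|w1] := leP (2^-1) `|w|.
    by rewrite tent_out// mul0r normr0 mulr_ge0// (le_trans _ (fc w)).
  rewrite indicE mem_set; last by rewrite /= in_itv/= -ler_norml ltW.
  rewrite mulr1 normrM (ger0_norm (tent_ge0 _)).
  rewrite -[leRHS]mul1r ler_pM ?tent_ge0// (le_trans (tent_le w))//; lra.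
- by apply: integrableRZ => //; exact: integrable_indic_itv.
Qed.

Definition kap h : R := \int[mu]_w (tent w * tent (w + h)).

Lemma measurable_tent_shift h : measurable_fun setT (fun w => tent (w + h)).
Proof.
by apply: (measurableT_comp measurable_tent); exact: measurable_funD.
Qed.

Lemma norm_tent_le w : `|tent w| <= 2^-1.
Proof. by rewrite ger0_norm ?tent_ge0 ?tent_le. Qed.

Lemma integrable_kap h : mu.-integrable setT (EFin \o (fun w => tent w * tent (w + h))).
Proof.
apply: (@integrable_tentM _ (2^-1)); first exact: measurable_tent_shift.
by move=> w; exact: norm_tent_le.
Qed.

Lemma integrable_tent_shiftM x y :
  mu.-integrable setT (EFin \o (fun w => tent (w + x) * tent (w + y))).
Proof.
have := integrable_shift x (integrable_kap (y - x)).
rewrite (_ : (fun w => _) = (fun w => tent (w + x) * tent (w + y)))//.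
by apply/funext => w; rewrite -addrA [x + _]addrC subrK.
Qed.

Lemma Rintegral_tent_shiftM x y :
  \int[mu]_w (tent (w + x) * tent (w + y)) = kap (y - x).
Proof.
rewrite -[RHS](Rintegral_shift x); last exact: integrable_kap.
by apply: eq_Rintegral => w _; rewrite -addrA [x + _]addrC subrK.
Qed.

Lemma kapN h : kap (- h) = kap h.
Proof.
rewrite -[- h]add0r -[h in RHS]subr0 -!Rintegral_tent_shiftM.
by apply: eq_Rintegral => w _; rewrite mulrC.
Qed.

(** A translation of the integration variable exhibits the kernel as an integral over [w] of
    rank-one kernels. *)
Lemma psd_kap (I : finType) (x : I -> R) : psd (fun i j => kap (x i - x j)).
Proof.
apply: eq_psd (@psd_Rintegral _ _ _ mu setT I
  (fun w i j => tent (w + x j) * tent (w + x i)) measurableT _ _) => [i j|w _|i j].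
- by rewrite Rintegral_tent_shiftM.
- by apply: eq_psd (psd_rank1 (fun i => tent (w + x i))) => i j; rewrite mulrC.
- exact: integrable_tent_shiftM.
Qed.

Lemma kap_ge0 h : 0 <= kap h.
Proof. by apply: Rintegral_ge0 => w _; rewrite mulr_ge0 ?tent_ge0. Qed.

Lemma kap_out h : 1 <= `|h| -> kap h = 0.
Proof.
move=> h1; rewrite /kap (_ : (fun=> _) = fun=> 0) ?Rintegral_cst ?mul0r//.
apply/funext => w; have [w1|w1] := leP (2^-1) `|w|; first by rewrite tent_out ?mul0r.
rewrite [tent (w + h)]tent_out ?mulr0//.
have := ler_normB (w + h) w; rewrite addrAC subrr add0r; lra.
Qed.

Lemma kap0_gt0 : 0 < kap 0.
Proof.
(* On [[-1/4, 1/4]] the tent is at least [1/4], so its square is at least [1/16]. *)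
apply: (@lt_le_trans _ _ (16^-1 * (4^-1 - - 4^-1))); first by lra.
rewrite -(@Rintegral_cst_itv _ _ (- 4^-1)); last by lra.
apply: le_Rintegral => //; first exact: integrableRZ (integrable_indic_itv _ _ _ _).
  exact: integrable_kap.
move=> w _; rewrite addr0 indicE; have [|_] := boolP (w \in _); last first.
  by rewrite mulr0 mulr_ge0 ?tent_ge0.
rewrite inE/= in_itv/= -ler_norml => w4.
have t : 4^-1 <= tent w by rewrite le_max; apply/orP; right; lra.
by rewrite mulr1; nra.
Qed.

Lemma kap_le h : kap h <= 4^-1.
Proof.
have -> : 4^-1 = 4^-1 * (2^-1 - - 2^-1) :> R by lra.
rewrite -(@Rintegral_cst_itv _ _ (- 2^-1)); last by lra.
apply: le_Rintegral => //; first exact: integrable_kap.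
  exact: integrableRZ (integrable_indic_itv _ _ _ _).
move=> w _; have [w1|w1] := leP (2^-1) `|w|.
  by rewrite tent_out// mul0r mulr_ge0// invr_ge0.
rewrite indicE mem_set; last by rewrite /= in_itv/= -ler_norml ltW.
rewrite mulr1 (_ : 4^-1 = 2^-1 * 2^-1); last by lra.
by rewrite ler_pM ?tent_ge0 ?tent_le.
Qed.

(** Expand the square: both translates of the tent have square norm [kap 0]. The formula gives the
    sign of the difference and, with the Lipschitz bound, its quadratic decay at [0]. *)
Lemma kap0B h : kap 0 - kap h = 2^-1 * \int[mu]_w (tent (w + h) - tent w) ^+ 2.
Proof.
have i1 := integrable_tent_shiftM h h; have i2 := integrable_tent_shiftM 0 h.
have i3 := integrable_tent_shiftM 0 0.
have -> : (fun w => (tent (w + h) - tent w) ^+ 2) = (fun w =>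
    tent (w + h) * tent (w + h) + tent (w + 0) * tent (w + 0) -
    2 * (tent (w + 0) * tent (w + h))).
  by apply/funext => w; rewrite addr0; ring.
rewrite RintegralB//; [|exact: integrableRD|exact: integrableRZ].
rewrite RintegralD// RintegralZl// !Rintegral_tent_shiftM !subrr subr0.
lra.
Qed.

Lemma kap0B_ge0 h : 0 <= kap 0 - kap h.
Proof.
rewrite kap0B mulr_ge0 ?invr_ge0// Rintegral_ge0// => w _; exact: sqr_ge0.
Qed.

Lemma kap0B_le h : kap 0 - kap h <= 2 * h ^+ 2.
Proof.
have [h1|h1] := leP 1 `|h|.
  rewrite (kap_out h1) subr0 (le_trans (kap_le 0))//.
  have : 1 <= h ^+ 2 by rewrite -real_normK ?num_real// exprn_ege1.
  lra.
rewrite kap0B.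
(* For [|h| < 1] the increment is at most [|h|] and vanishes outside [[-3/2, 3/2]]. *)
suff : \int[mu]_w (tent (w + h) - tent w) ^+ 2 <= h ^+ 2 * (3 / 2 - - (3 / 2)).
  by have := sqr_ge0 h; lra.
rewrite -(@Rintegral_cst_itv _ _ (- (3 / 2))); last by lra.
have b w : (tent (w + h) - tent w) ^+ 2 <= h ^+ 2 * \1_(`[- (3 / 2), 3 / 2]%classic) w.
  rewrite indicE; have [_|] := boolP (w \in _).
    rewrite mulr1 -real_normK ?num_real// -[leRHS]real_normK ?num_real//.
    rewrite ler_sqr ?nnegrE//.
    by have := tent_lip (w + h) w; rewrite addrAC subrr add0r.
  rewrite notin_setE/= in_itv/= -ler_norml => /negP; rewrite -ltNge => w3.
  rewrite !tent_out ?subrr ?expr0n ?mulr0//; first lra.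
  have := ler_normB (w + h) h; rewrite addrK; lra.
apply: le_Rintegral => //.
  apply: (@le_integrableR _ _ _ mu setT measurableT _
      (fun w => h ^+ 2 * \1_(`[- (3 / 2), 3 / 2]%classic) w)).
  - apply: measurable_funX; apply: measurable_funB; last exact: measurable_tent.
    exact: measurable_tent_shift.
  - by move=> w _; rewrite ger0_norm ?sqr_ge0.
  - exact: integrableRZ (integrable_indic_itv _ _ _ _).
exact: integrableRZ (integrable_indic_itv _ _ _ _).
Qed.

(** Yields continuity, hence the measurability of [kap] required by the Mellin integrals. *)
Lemma kap_lip x y : `|kap x - kap y| <= `|x - y|.
Proof.
rewrite /kap -RintegralB//; [|exact: integrable_kap..].
have m : measurable_fun setT (fun w => tent (w + x) - tent (w + y)).
  by apply: measurable_funB; exact: measurable_tent_shift.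
have b w : `|tent (w + x) - tent (w + y)| <= `|x - y|.
  by rewrite (le_trans (tent_lip _ _))// opprD addrACA subrr add0r.
have i : mu.-integrable setT (EFin \o (fun w => tent w * (tent (w + x) - tent (w + y)))).
  exact: (integrable_tentM m b).
under eq_Rintegral do rewrite -mulrBr.
rewrite (le_trans (le_normr_Rintegral _ i))//.
rewrite -[leRHS]mulr1 (_ : 1 = 2^-1 - - 2^-1) -?Rintegral_cst_itv//; try lra.
apply: le_Rintegral => //; first exact: integrable_norm.
  exact: integrableRZ (integrable_indic_itv _ _ _ _).
move=> w _; have [w1|w1] := leP (2^-1) `|w|.
  by rewrite tent_out// mul0r normr0 mulr_ge0.
rewrite indicE mem_set; last by rewrite /= in_itv/= -ler_norml ltW.
rewrite mulr1 normrM (ger0_norm (tent_ge0 _)) -[leRHS]mul1r.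
by rewrite ler_pM ?tent_ge0 ?b// (le_trans (tent_le w))//; lra.
Qed.

Lemma measurable_kap : measurable_fun setT kap.
Proof.
apply: continuous_measurable_fun => x.
apply/cvgrPdist_lt => e e0; near=> y.
by rewrite (le_lt_trans (kap_lip x y))//; near: y; exact: cvgr_dist_lt.
Unshelve. all: by end_near. Qed.

End tent_autocorrelation.

(** * Powers as Mellin integrals *)

Section mellin.
Context {R : realType}.
Local Notation mu := (@lebesgue_measure R).
Implicit Types (f : R -> R) (p x v : R).

(** With [u = e^v] this is the integral of [f (x / u) u^(p-1)] over [u > 0], a function of [x]
    homogeneous of degree [p] on the half-line. *)
Definition mellin f p x : R := \int[mu]_v (f (x * expR (- v)) * expR (p * v)).

Lemma measurable_mellin f p x : measurable_fun setT f ->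
  measurable_fun setT (fun v => f (x * expR (- v)) * expR (p * v)).
Proof.
move=> mf; apply: measurable_funM.
  apply: (measurableT_comp mf); apply: measurable_funM => //.
  by apply: (measurableT_comp (@measurable_expR R)).
apply: (measurableT_comp (@measurable_expR R)).
exact: measurable_funM.
Qed.

Section mellin_dominated.
Variables (f : R -> R) (C : R) (n : nat) (p : R).
Hypothesis mf : measurable_fun setT f.
Hypothesis f0 : forall x, 0 <= f x.
Hypothesis fC : forall x, f x <= C.
Hypothesis fn : forall x, f x <= C * `|x| ^+ n.
Hypothesis p0 : 0 < p.
Hypothesis pn : p < n%:R.

(** The bound [fC] serves for [v < 0], where [e^(p v)] decays; [fn] serves for [v >= 0], where it
    leaves [e^(-(n - p) v)]. *)
Lemma integrable_mellin x :
  mu.-integrable setT (EFin \o (fun v => f (x * expR (- v)) * expR (p * v))).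
Proof.
have C0 : 0 <= C := le_trans (f0 0) (fC 0).
apply: (@le_integrableR _ _ _ mu setT measurableT _ (fun v =>
    C * (1 + `|x| ^+ n) * (expR (- p * `|v|) + expR (- (n%:R - p) * `|v|)))).
- exact: measurable_mellin.
- move=> v _; rewrite ger0_norm ?mulr_ge0 ?expR_ge0//.
  have e0 := expR_ge0 (- p * `|v|); have e1 := expR_ge0 (- (n%:R - p) * `|v|).
  have xn : 0 <= `|x| ^+ n by rewrite exprn_ge0.
  have [v0|v0] := leP 0 v.
    apply: (@le_trans _ _ (C * `|x| ^+ n * expR (- (n%:R - p) * `|v|))).
      rewrite (ger0_norm v0) (_ : - (n%:R - p) * v = n%:R * - v + p * v); last by ring.
      rewrite expRD mulrA ler_wpM2r ?expR_ge0//.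
      rewrite (le_trans (fn _))// normrM exprMn (ger0_norm (expR_ge0 _)).
      by rewrite expRM_natl mulrA.
    have := mulr_ge0 C0 xn; have := mulr_ge0 C0 e1; have := mulr_ge0 C0 e0.
    by have := mulr_ge0 (mulr_ge0 C0 xn) e0; nra.
  apply: (@le_trans _ _ (C * expR (- p * `|v|))).
    by rewrite ltr0_norm// mulrNN ler_wpM2r ?expR_ge0.
  have := mulr_ge0 C0 e1; have := mulr_ge0 (mulr_ge0 C0 xn) e1.
  by have := mulr_ge0 (mulr_ge0 C0 xn) e0; nra.
- apply: integrableRZ => //; apply: integrableRD => //.
    exact: integrable_expRNnorm.
  by apply: integrable_expRNnorm; rewrite subr_gt0.
Qed.

(* The substitution [v -> v + ln x] turns dilation of [f] into a translation. *)
Lemma mellin_powR x : 0 <= x -> mellin f p x = mellin f p 1 * x `^ p.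
Proof.
rewrite le_eqVlt => /predU1P[<-|x0].
  rewrite powR0 ?gt_eqF// mulr0 /mellin (_ : (fun=> _) = fun=> 0).
    by rewrite Rintegral_cst// mul0r.
  apply/funext => v; rewrite mul0r (_ : f 0 = 0) ?mul0r//.
  apply/eqP; rewrite eq_le f0 andbT (le_trans (fn 0))// normr0 expr0n.
  case: n pn => [|m _]; last by rewrite mulr0.
  by move=> /(lt_trans p0); rewrite ltxx.
rewrite /mellin -RintegralZr//; last exact: integrable_mellin.
rewrite -(Rintegral_shift (ln x)); last exact: integrable_mellin.
apply: eq_Rintegral => v _.
have -> : x * expR (- (v + ln x)) = 1 * expR (- v).
  by rewrite opprD expRD (expRN (ln x)) lnK ?posrE// mulrCA divff ?gt_eqF// mulrC.
by rewrite mulrDr expRD mulrA /powR gt_eqF.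
Qed.

(** On [-1 <= v <= 0] the argument [e^(-v)] is at least [1], so the integrand is at least [m e^(-p)]
    on an interval of length one. *)
Lemma mellin1_gt0 m : 0 < m -> (forall x, 1 <= x -> m <= f x) ->
  0 < mellin f p 1.
Proof.
move=> m0 fm; apply: (@lt_le_trans _ _ (m * expR (- p) * (0 - (- 1)))).
  by rewrite opprK add0r mulr1 mulr_gt0// expR_gt0.
rewrite -(@Rintegral_cst_itv _ _ (- 1)) ?lerN10//.
apply: le_Rintegral => //.
- exact: integrableRZ (integrable_indic_itv _ _ _ _).
- exact: integrable_mellin.
move=> v _; rewrite indicE; have [|_] := boolP (v \in _); last first.
  by rewrite mulr0 mulr_ge0 ?expR_ge0.
rewrite inE/= in_itv/= => /andP[v1 v0]; rewrite mulr1 mul1r.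
apply: ler_pM; rewrite ?expR_ge0 ?(ltW m0)//.
  by apply: fm; rewrite -expR0 ler_expR oppr_ge0.
by rewrite ler_expR -[leLHS]mulr1 mulNr -mulrN ler_wpM2l// ltW.
Qed.

End mellin_dominated.

(** The classical representation of [x^K], where [c] is [Gamma(1 - K) / K]. The function
    [1 - e^(-|x|)] is linear at [0], so the case [n = 1] applies, with [K < 1]; the absolute value
    keeps it nonnegative on the whole line. *)
Lemma powR_expRN_mellin (K : R) : 0 < K < 1 ->
  exists2 c : R, 0 < c & forall x, 0 <= x ->
    mu.-integrable setT
      (EFin \o (fun v => (1 - expR (- `|x * expR (- v)|)) * expR (K * v))) /\
    \int[mu]_v ((1 - expR (- `|x * expR (- v)|)) * expR (K * v)) = c * x `^ K.
Proof.
move=> /andP[K0 K1]; pose f (x : R) : R := 1 - expR (- `|x|).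
have mf : measurable_fun setT f.
  apply: measurable_funB => //; apply: (measurableT_comp (@measurable_expR R)).
  by apply: measurableT_comp => //; exact: measurableT_comp.
have f0 x : 0 <= f x by rewrite subr_ge0 expR_le1 oppr_le0.
have fC x : f x <= 1 by rewrite gerBl expR_ge0.
have fn x : f x <= 1 * `|x| ^+ 1.
  by rewrite mul1r expr1 lerBlDr -lerBlDl (le_trans _ (expR_ge1Dx _)).
exists (mellin f K 1).
  apply: (@mellin1_gt0 f 1 1 K mf f0 fC fn K0 K1 (1 - expR (- 1))).
    by rewrite subr_gt0 expR_lt1 oppr_lt0.
  by move=> x x1; rewrite lerB// ler_expR lerN2 ger0_norm// (le_trans _ x1).
move=> x x0; split; first exact: (integrable_mellin mf f0 fC fn K0 K1).
exact: (mellin_powR mf f0 fC fn K0 K1).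
Qed.

(* [x^K] is a positive mixture of the functions [1 - e^(-s x)], and
   [e^(-s B) - e^(-s A) = e^(-s A) (e^(s (A - B)) - 1)]. *)
Lemma psd_powRB (I : finType) (A B : I -> I -> R) (K : R) : 0 < K <= 1 ->
  (forall i j, 0 <= A i j) -> (forall i j, 0 <= B i j) ->
  psd (fun i j => A i j - B i j) ->
  (forall t : R, 0 < t -> psd (fun i j => expR (- t * A i j))) ->
  psd (fun i j => A i j `^ K - B i j `^ K).
Proof.
move=> /andP[K0]; rewrite le_eqVlt => /predU1P[-> A0 B0 AB _|K1 A0 B0 AB eA].
  by apply: eq_psd AB => i j; rewrite !powRr1.
have [|c c0 h] := @powR_expRN_mellin K; first by rewrite K0.
pose g (x v : R) := (1 - expR (- `|x * expR (- v)|)) * expR (K * v).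
have gi x : 0 <= x -> mu.-integrable setT (EFin \o g x).
  by move=> x0; exact: (h x x0).1.
apply: (@eq_psd _ _ (fun i j => c^-1 * \int[mu]_v (g (A i j) v - g (B i j) v))).
  move=> i j; rewrite RintegralB//; [|exact: gi..].
  by rewrite (h _ (A0 i j)).2 (h _ (B0 i j)).2 -mulrBr mulKf// gt_eqF.
apply: psdZ; first by rewrite invr_ge0 ltW.
apply: psd_Rintegral => // [v _|i j]; last by apply: integrableRB => //; exact: gi.
have e0 := expR_gt0 (- v).
apply: (@eq_psd _ _ (fun i j => expR (K * v) * (expR (- expR (- v) * A i j) *
    (expR (expR (- v) * (A i j - B i j)) - 1)))).
  move=> i j; rewrite /g !ger0_norm ?mulr_ge0 ?expR_ge0//.
  rewrite [in LHS]mulrBr mulr1 -expRD.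
  rewrite (_ : - _ * _ + _ = - (B i j * expR (- v))); last by ring.
  by rewrite (_ : - _ * A i j = - (A i j * expR (- v))); ring.
apply: psdZ; first exact: expR_ge0.
apply: psdM; first exact: eA.
by apply: psd_expRB1; apply: psdZ => //; exact: ltW.
Qed.

End mellin.

(** * The bifractional Brownian kernel *)

(** Write [w] as [e_i0 + u] with [u i0 = 0]: the cross term vanishes and the form at [u] is
    nonnegative. In the application [i0] is the predicted time and the other coefficients are those
    of minus the predictor. *)
Lemma psd_form_ge (R : realType) (I : finType) (k : I -> I -> R) (i0 : I) (w : I -> R) :
  psd k -> (forall j, j != i0 -> k i0 j = 0) -> w i0 = 1 ->
  k i0 i0 <= \sum_i \sum_j w i * w j * k i j.
Proof.
move=> [s p] k0 w0; pose u i := w i - (i == i0)%:R.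
rewrite [leRHS](_ : _ = \sum_i \sum_j (u i + 1 * (i == i0)%:R) *
    (u j + 1 * (j == i0)%:R) * k i j); last first.
  by apply: eq_bigr => i _; apply: eq_bigr => j _; rewrite /u !mul1r !subrK.
rewrite psd_form_shift// (_ : \sum_j u j * k i0 j = 0); last first.
  rewrite big1// => j _; have [->|/k0 ->] := eqVneq j i0; last by rewrite mulr0.
  by rewrite /u w0 eqxx subrr mul0r.
by rewrite mulr0 addr0 expr1n mul1r lerDr.
Qed.

Section fractional_kernels.
Context {R : realType}.
Local Notation mu := (@lebesgue_measure R).
Variable (b : R).
Hypothesis b0 : 0 < b.
Hypothesis b2 : b < 2.

Let f (x : R) : R := kap 0 - kap x.

Let mf : measurable_fun setT f.
Proof. by apply: measurable_funB => //; exact: measurable_kap. Qed.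

Let f0 x : 0 <= f x. Proof. exact: kap0B_ge0. Qed.

Let fC x : f x <= 2.
Proof. rewrite /f; have := @kap_le R 0; have := @kap_ge0 R x; lra. Qed.

Let fn x : f x <= 2 * `|x| ^+ 2.
Proof. by rewrite real_normK ?num_real//; exact: kap0B_le. Qed.

Let imellin := @integrable_mellin R f 2 2 b mf f0 fC fn b0 b2.

Definition kap_cst : R := mellin (fun x => kap 0 - kap x) b 1.

Lemma kap_cst_gt0 : 0 < kap_cst.
Proof.
apply: (@mellin1_gt0 _ f 2 2 b mf f0 fC fn b0 b2 (kap 0)); first exact: kap0_gt0.
move=> x x1; rewrite /f (@kap_out _ x) ?subr0//.
by rewrite ger0_norm// (le_trans _ x1).
Qed.

Lemma mellin_kap x : mellin f b x = kap_cst * `|x| `^ b.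
Proof.
rewrite -(@mellin_powR _ f 2 2 b mf f0 fC fn b0 b2 _ (normr_ge0 x)).
have [x0|x0] := leP 0 x; first by rewrite ger0_norm.
have fN y : f (- y) = f y by rewrite /f kapN.
rewrite (ltr0_norm x0) /mellin.
by under [in RHS]eq_Rintegral do rewrite mulNr fN.
Qed.

(** The [V] of the overview for [l = ln r]: only scales [e^v <= r] are kept, at which points [r]
    apart do not interact. The cut also makes the integral converge at [h = 0], where [kap] stays at
    its maximum for all [v]. *)
Definition kap_low (l h : R) : R :=
  \int[mu]_v (\1_(`]-oo, l]%classic) v * (kap (h * expR (- v)) * expR (b * v))).

Lemma integrable_kap_low l h : mu.-integrable setT
  (EFin \o (fun v => \1_(`]-oo, l]%classic) v * (kap (h * expR (- v)) * expR (b * v)))).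
Proof.
apply: (@le_integrableR _ _ _ mu setT measurableT _
  (* For [v <= l] one has [v <= 2 |l| - |v|], which turns the growth of [e^(b v)] into decay in
     [|v|]. *)
  (fun v => expR (2 * b * `|l|) * expR (- b * `|v|))).
- apply: measurable_funM; first exact: measurable_indic.
  by apply: measurable_mellin; exact: measurable_kap.
- move=> v _; rewrite indicE; have [|_] := boolP (v \in _); last first.
    by rewrite mul0r normr0 mulr_ge0 ?expR_ge0.
  rewrite inE/= in_itv/= => vl.
  rewrite mul1r ger0_norm ?mulr_ge0 ?kap_ge0 ?expR_ge0// -[leRHS]mul1r.
  apply: ler_pM; rewrite ?kap_ge0 ?expR_ge0//.
    by rewrite (le_trans (kap_le _))//; lra.
  rewrite -expRD ler_expR (_ : _ + _ = b * (2 * `|l| - `|v|)); last by ring.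
  rewrite ler_pM2l//; have := ler_norm l; have := normr_ge0 l.
  by have [v0|v0] := leP 0 v; [rewrite (ger0_norm v0)|rewrite (ltr0_norm v0)]; lra.
- by apply: integrableRZ => //; exact: integrable_expRNnorm.
Qed.

Lemma psd_kap_low (I : finType) (x : I -> R) l : psd (fun i j => kap_low l (x i - x j)).
Proof.
apply: psd_Rintegral => // [v _|i j]; last exact: integrable_kap_low.
apply: psdZ; first by rewrite indicE.
apply: (@eq_psd _ _ (fun i j => expR (b * v) *
    kap (x i * expR (- v) - x j * expR (- v)))); last first.
  by apply: psdZ; [exact: expR_ge0|exact: psd_kap].
by move=> i j; rewrite mulrBl mulrC.
Qed.

Lemma kap_low_ge0 l h : 0 <= kap_low l h.
Proof.
by apply: Rintegral_ge0 => v _; rewrite !mulr_ge0 ?kap_ge0 ?expR_ge0// indicE.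
Qed.

Lemma kap_low_out r h : 0 < r -> r <= `|h| -> kap_low (ln r) h = 0.
Proof.
move=> r0 rh; rewrite /kap_low (_ : (fun=> _) = fun=> 0) ?Rintegral_cst ?mul0r//.
apply/funext => v; rewrite indicE; have [|_] := boolP (v \in _); last by rewrite mul0r.
rewrite inE/= in_itv/= => vl; rewrite kap_out ?mul0r ?mulr0//.
rewrite normrM (ger0_norm (expR_ge0 _)) expRN ler_pdivlMr ?expR_gt0// mul1r.
by rewrite (le_trans _ rh)// -(lnK (x := r)) ?posrE// ler_expR.
Qed.

Lemma kap_low0_ge r : 0 < r -> kap 0 * expR (- b) * r `^ b <= kap_low (ln r) 0.
Proof.
move=> r0; set l := ln r.
(* The exact value is [kap 0 * r^b / b]; a lower bound on the unit window below [ln r] is enough. *)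
rewrite [leLHS](_ : _ = kap 0 * expR (b * (l - 1)) * (l - (l - 1))); last first.
  rewrite /powR gt_eqF// -/l opprB addrCA subrr addr0 mulr1 -mulrA -expRD.
  by congr (_ * expR _); ring.
rewrite -(@Rintegral_cst_itv _ _ (l - 1)); last by rewrite gerBl.
apply: le_Rintegral => //.
- exact: integrableRZ (integrable_indic_itv _ _ _ _).
- exact: integrable_kap_low.
move=> v _; rewrite !indicE; have [|_] := boolP (v \in `[l - 1, l]%classic); last first.
  by rewrite mulr0 !mulr_ge0 ?kap_ge0 ?expR_ge0.
rewrite inE/= in_itv/= => /andP[lv vl]; rewrite mulr1 mem_set/=; last first.
  by rewrite in_itv.
rewrite mul1r mul0r ler_wpM2l ?kap_ge0// ler_expR ler_wpM2l//; exact: ltW.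
Qed.

(* For [v <= ln r] all [x i * e^(-v)] lie outside the support of [kap] and the
   integrand is constant in [i, j]; for [v > ln r] it is a Gram kernel of tent
   increments. *)
Lemma psd_fbm_sub_low (I : finType) (x : I -> R) (r : R) : 0 < r ->
  (forall i, r <= x i) ->
  psd (fun i j => kap_cst * (x i `^ b + x j `^ b) - kap_cst * `|x i - x j| `^ b
                  - kap_low (ln r) (x i - x j)).
Proof.
move=> r0 rx; pose y v i := x i * expR (- v).
have x0 i : 0 <= x i by rewrite (le_trans _ (rx i))// ltW.
pose k v (i j : I) := (f (y v i) * expR (b * v) + f (y v j) * expR (b * v)
  - f ((x i - x j) * expR (- v)) * expR (b * v))
  - \1_(`]-oo, ln r]%classic) v * (kap ((x i - x j) * expR (- v)) * expR (b * v)).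
apply: (@eq_psd _ _ (fun i j => \int[mu]_v k v i j)).
  move=> i j; rewrite /k RintegralB//; first last.
  - exact: integrable_kap_low.
  - exact: (integrableRB measurableT (integrableRD measurableT (imellin _) (imellin _)) (imellin _)).
  rewrite -/(kap_low _ _) RintegralB//; last first.
    exact: (integrableRD measurableT (imellin _) (imellin _)).
  rewrite RintegralD//; [|exact: imellin..].
  by rewrite -!/(mellin f b _) !mellin_kap (ger0_norm (x0 i)) (ger0_norm (x0 j)); ring.
apply: psd_Rintegral => // [v _|i j]; last first.
  apply: integrableRB => //; last exact: integrable_kap_low.
  exact: (integrableRB measurableT (integrableRD measurableT (imellin _) (imellin _)) (imellin _)).
have [vl|vl] := leP v (ln r).
  apply: (@eq_psd _ _ (fun _ _ => expR (b * v) * kap 0)); last first.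
    by apply: psd_cst; rewrite mulr_ge0 ?expR_ge0 ?kap_ge0.
  move=> i j; rewrite /k indicE mem_set/= ?in_itv//= /f.
  have yo i' : kap (y v i') = 0.
    rewrite kap_out// ger0_norm ?mulr_ge0 ?expR_ge0// /y expRN.
    rewrite ler_pdivlMr ?expR_gt0// mul1r (le_trans _ (rx i'))//.
    by rewrite -(lnK (x := r)) ?posrE// ler_expR.
  by rewrite !yo; ring.
apply: (@eq_psd _ _ (fun i j => expR (b * v) * \int[mu]_w
   ((tent (w + y v i) - tent (w + 0)) * (tent (w + y v j) - tent (w + 0))))); last first.
  apply: psdZ; first exact: expR_ge0.
  apply: psd_Rintegral => // [w _|i j].
    exact: (psd_rank1 (fun i => tent (w + y v i) - tent (w + 0))).
  rewrite (_ : (fun w => _) = (fun w => tent (w + y v i) * tent (w + y v j)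
     + tent (w + 0) * tent (w + 0) - (tent (w + y v i) * tent (w + 0)
     + tent (w + 0) * tent (w + y v j)))).
    by apply: integrableRB => //; apply: integrableRD => //; exact: integrable_tent_shiftM.
  by apply/funext => w; ring.
move=> i j; rewrite /k indicE memNset/=; last by rewrite in_itv/=; apply/negP; rewrite -ltNge.
rewrite (_ : (fun w => _) = (fun w => tent (w + y v i) * tent (w + y v j)
   + tent (w + 0) * tent (w + 0) - (tent (w + y v i) * tent (w + 0)
   + tent (w + 0) * tent (w + y v j)))); last by apply/funext => w; ring.
rewrite RintegralB//; [|by apply: integrableRD => //; exact: integrable_tent_shiftM..].
rewrite !RintegralD//; [|exact: integrable_tent_shiftM..].
rewrite !Rintegral_tent_shiftM !subrr sub0r subr0 kapN.
rewrite (_ : kap (y v j - y v i) = kap ((x i - x j) * expR (- v))).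
  by rewrite /f; ring.
by rewrite -kapN opprB /y mulrBl.
Qed.

Lemma bifractional_form_ge (K : R) : 0 < K <= 1 ->
  exists2 c : R, 0 < c &
  forall (I : finType) (x w : I -> R) (i0 : I) (r : R), 0 < r ->
    (forall i, r <= x i) -> (forall i, i != i0 -> r <= `|x i - x i0|) ->
    w i0 = 1 ->
    c * r `^ (b * K) <= \sum_i \sum_j w i * w j *
      ((x i `^ b + x j `^ b) `^ K - `|x i - x j| `^ (b * K)).
Proof.
move=> K01; have /andP[K0 K1] := K01; have C0 := kap_cst_gt0.
have CK0 : 0 < kap_cst `^ K by rewrite powR_gt0.
exists ((kap_cst `^ K)^-1 * (kap 0 * expR (- b)) `^ K).
  by rewrite mulr_gt0 ?invr_gt0// powR_gt0// mulr_gt0 ?expR_gt0 ?kap0_gt0.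
move=> I x w i0 r r0 rx rxi0 w0.
have x0 i : 0 <= x i by rewrite (le_trans _ (rx i))// ltW.
pose A i j := kap_cst * (x i `^ b + x j `^ b).
pose B i j := kap_cst * `|x i - x j| `^ b.
pose V i j := kap_low (ln r) (x i - x j).
pose D i j := B i j + V i j.
have A0 i j : 0 <= A i j by rewrite mulr_ge0 ?addr_ge0 ?powR_ge0// ltW.
have B0 i j : 0 <= B i j by rewrite mulr_ge0 ?powR_ge0// ltW.
have V0 i j : 0 <= V i j by exact: kap_low_ge0.
have D0 i j : 0 <= D i j by rewrite addr_ge0.
have pW : psd (fun i j => A i j - D i j).
  by apply: eq_psd (psd_fbm_sub_low r0 rx) => i j; rewrite /D opprD addrA.
(* [A] is a function of [i] plus the same function of [j], so the exponential has rank one. *)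
have eA (t : R) : psd (fun i j => expR (- t * A i j)).
  apply: eq_psd (psd_rank1 (fun i => expR (- t * (kap_cst * x i `^ b)))) => i j.
  by rewrite -expRD /A; congr expR; ring.
(* Schur product: [e^(-t D) = e^(-t A) e^(t (A - D))]. This lets [D] be the larger kernel in the
   second comparison. *)
have eD (t : R) : 0 < t -> psd (fun i j => expR (- t * D i j)).
  move=> t0; apply: eq_psd (psdM (eA t) (psd_expR (psdZ (ltW t0) pW))) => i j.
  by rewrite -expRD; congr expR; ring.
have p1 : psd (fun i j => A i j `^ K - D i j `^ K).
  by apply: psd_powRB => // t _; exact: eA.
have p2 : psd (fun i j => D i j `^ K - B i j `^ K).
  apply: psd_powRB => //.
  by apply: eq_psd (psd_kap_low x (ln r)) => i j; rewrite /D addrAC subrr add0r.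
have h1 := p1.2 w.
have Bi0 : B i0 i0 = 0 by rewrite /B subrr normr0 powR0 ?gt_eqF// mulr0.
(* [V] vanishes between [i0] and every other index, so row [i0] of [D^K - B^K] is zero off the
   diagonal; at [(i0, i0)], [B] is zero and [V^K] remains. *)
have h2 : (kap 0 * expR (- b)) `^ K * r `^ (b * K) <=
    \sum_i \sum_j w i * w j * (D i j `^ K - B i j `^ K).
  apply: le_trans (psd_form_ge p2 _ w0); last first.
    move=> j ji0; rewrite /D /V kap_low_out ?addr0 ?subrr// distrC; exact: rxi0.
  rewrite Bi0 (@powR0 _ K) ?gt_eqF// subr0 /D Bi0 add0r /V subrr.
  rewrite powRrM -powRM ?powR_ge0 ?mulr_ge0 ?expR_ge0 ?kap_ge0//.
  apply: ge0_ler_powR; rewrite ?(ltW K0) ?nnegrE ?kap_low_ge0 ?mulr_ge0 ?expR_ge0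
    ?kap_ge0 ?powR_ge0//.
  exact: kap_low0_ge.
rewrite -mulrA ler_pdivrMl//.
rewrite [leRHS](_ : _ = \sum_i \sum_j w i * w j * (A i j `^ K - D i j `^ K) +
    \sum_i \sum_j w i * w j * (D i j `^ K - B i j `^ K)); first by lra.
rewrite mulr_sumr -big_split; apply: eq_bigr => i _.
rewrite mulr_sumr -big_split; apply: eq_bigr => j _ /=.
rewrite /A /B !powRM ?addr_ge0 ?powR_ge0 ?(ltW C0)// -powRrM; ring.
Qed.

End fractional_kernels.

(** * Trigonometric moments of Gaussian variables *)

Section normal_density_integrals.
Context {R : realType}.
Local Notation mu := (@lebesgue_measure R).

Lemma integral_normal_prob (m s : R) (f : R -> \bar R) :
  (normal_prob m s).-integrable setT f ->
  (\int[normal_prob m s]_x f x = \int[mu]_x (f x * (normal_pdf m s x)%:E))%E.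
Proof.
move=> fi; have mf := measurable_int _ fi.
rewrite -(Radon_Nikodym_change_of_variables (normal_prob_dominates m s))//.
apply: ae_eq_integral => //.
- apply: emeasurable_funM => //; apply: (measurable_int mu).
  by apply: Radon_Nikodym_integrable; exact: normal_prob_dominates.
- apply: emeasurable_funM => //; apply/measurable_EFinP.
  exact: measurable_normal_pdf.
- apply: ae_eqe_mul2l => /=.
  rewrite Radon_NikodymE//=; first exact: normal_prob_dominates.
  move=> nmu; case: cid => /= h [h1 h2 h3].
  apply: integral_ae_eq => //=.
  + by apply/measurableT_comp => //; exact: measurable_normal_pdf.
  + by move=> E _ mE; rewrite -h3.
Qed.

Lemma integrable_normal_prob (m s : R) (f : R -> R) :
  (normal_prob m s).-integrable setT (EFin \o f) ->
  mu.-integrable setT (EFin \o (fun x => f x * normal_pdf m s x)).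
Proof.
move=> fi; have mf : measurable_fun setT f by apply/measurable_EFinP; exact: measurable_int fi.
have := fi => /integrable_abse /[dup] fai /integral_normal_prob h.
apply/integrableP; split.
  by apply/measurable_EFinP; apply: measurable_funM => //; exact: measurable_normal_pdf.
have := integrable_lty measurableT fai; rewrite h; apply: le_lt_trans.
rewrite le_eqVlt; apply/orP; left; apply/eqP; apply: eq_integral => x _ /=.
by rewrite normrM (ger0_norm (normal_pdf_ge0 _ _ _)).
Qed.

Lemma is_derive_normal_pdf (m s x : R) : s != 0 ->
  is_derive x 1 (normal_pdf m s) (- ((x - m) / s ^+ 2) * normal_pdf m s x).
Proof.
move=> s0; rewrite (normal_pdfE m s0).
have h : is_derive x 1 (fun y : R => - (y - m) ^+ 2 / (s ^+ 2 *+ 2)) (- ((x - m) / s ^+ 2)).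
  apply: is_derive_eq.
  rewrite /GRing.scale /= mulr0 add0r subr0 mulr1.
  by field; rewrite s0.
have h2 := is_derive1_comp (is_derive_expR _) h.
have h3 := @is_deriveZ _ _ _ _ (normal_peak s) _ _ _ h2.
apply: (@is_derive_eq _ _ _ _ _ _ _ _ h3).
by rewrite /GRing.scale/= /normal_fun; ring.
Qed.

(** From [e^u >= 1 + u]. Inverse-square decay suffices against the linear growth of [psi] in the
    boundary terms of [normal_stein]. *)
Lemma normal_pdf_le (m s x : R) : s != 0 -> x != m ->
  normal_pdf m s x <= normal_peak s * (2 * s ^+ 2 / (x - m) ^+ 2).
Proof.
move=> s0 xm; rewrite (normal_pdfE m s0) ler_wpM2l ?normal_peak_ge0//.
have d0 : 0 < (x - m) ^+ 2 by rewrite exprn_even_gt0//= subr_eq0.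
have s2 : 0 < s ^+ 2 by rewrite exprn_even_gt0.
rewrite /normal_fun mulNr expRN -mulr_natl -[leRHS]invf_div.
have u0 : 0 < (x - m) ^+ 2 / (2 * s ^+ 2).
  by apply: divr_gt0 => //; apply: mulr_gt0.
rewrite lef_pV2 ?posrE ?expR_gt0//.
by have := expR_ge1Dx ((x - m) ^+ 2 / (2 * s ^+ 2)); lra.
Qed.

Lemma cvg_Rintegral_itv (G : R -> R) (m : R) : mu.-integrable setT (EFin \o G) ->
  \int[mu]_(x in `[m - n.+1%:R, m + n.+1%:R]) G x @[n --> \oo] --> \int[mu]_x G x.
Proof.
move=> iG; have mG : measurable_fun setT G by apply/measurable_EFinP; exact: measurable_int iG.
apply: fine_cvg; rewrite fineK; last exact: integrable_fin_num.
under eq_fun do rewrite integral_mkcond restrict_EFin.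
apply: (@dominated_cvg _ _ _ mu setT measurableT _ _ (EFin \o (fun x => `|G x|))) => //.
- move=> n; apply/measurable_EFinP/(measurable_restrictT _ _).1 => //.
  exact: measurable_funS mG.
- move=> x _; apply: cvg_near_cst; near=> n.
  rewrite /= patchE mem_set//= in_itv/= -ler_distlC.
  near: n; have := nbhs_infty_ger `|m - x|; apply: filterS => n /le_trans; apply.
  by rewrite ler_nat.
- exact: integrable_norm.
- move=> n x _; rewrite /= lee_fin patchE; case: ifPn => // _.
  by rewrite normr0.
Unshelve. all: by end_near. Qed.

(** Stein's identity by integration by parts: [G] is the derivative of [psi] times the density, and
    the boundary values of that product tend to [0]. *)
Lemma normal_stein (m s A : R) (psi psi' : R -> R) : s != 0 ->
  (forall x : R, is_derive x 1 psi (psi' x)) -> continuous psi' ->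
  (forall x, `|psi x| <= A * (1 + `|x - m|)) ->
  mu.-integrable setT (EFin \o (fun x => psi' x * normal_pdf m s x)) ->
  mu.-integrable setT (EFin \o (fun x => (x - m) * psi x * normal_pdf m s x)) ->
  \int[mu]_x ((x - m) * psi x * normal_pdf m s x) =
  s ^+ 2 * \int[mu]_x (psi' x * normal_pdf m s x).
Proof.
move=> s0 dpsi cpsi' psiA i1 i2; set p := normal_pdf m s.
have s2 : s ^+ 2 != 0 by rewrite expf_neq0.
pose F x := psi x * p x.
pose G x := psi' x * p x - (s ^+ 2)^-1 * ((x - m) * psi x * p x).
have dF (x : R) : is_derive x 1 F (G x).
  have h := is_derive_normal_pdf m x s0.
  apply: (@is_derive_eq _ _ _ _ _ _ _ _ (is_deriveM (dpsi x) h)).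
  by rewrite /GRing.scale/= /G /p; field.
have cF (x : R) : {for x, continuous F}.
  by apply: differentiable_continuous; apply/derivable1_diffP; exact: ex_derive.
have cpsi (x : R) : {for x, continuous psi}.
  by apply: differentiable_continuous; apply/derivable1_diffP; exact: ex_derive.
have cp : continuous p by exact: continuous_normal_pdf.
have cG : continuous G.
  move=> x; apply: cvgB; first by apply: cvgM; [exact: cpsi'|exact: cp].
  apply: cvgM; first exact: cvg_cst.
  apply: cvgM; last exact: cp.
  apply: cvgM; last exact: cpsi.
  by apply: cvgB; [exact: cvg_id|exact: cvg_cst].
have iG : mu.-integrable setT (EFin \o G).
  by apply: integrableRB => //; exact: integrableRZ.
have e n : \int[mu]_(x in `[m - n.+1%:R, m + n.+1%:R]) G x =
    F (m + n.+1%:R) - F (m - n.+1%:R).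
  have lt : m - n.+1%:R < m + n.+1%:R.
    by rewrite ltrD2l (@lt_trans _ _ 0) ?oppr_lt0 ?ltr0n.
  rewrite /Rintegral (@continuous_FTC2 _ G F)//.
  - exact: continuous_subspaceT.
  - split.
    + by move=> x _; apply: ex_derive.
    + by apply: cvg_at_right_filter; exact: cF.
    + by apply: cvg_at_left_filter; exact: cF.
  - by move=> x _; rewrite derive1E; exact: derive_val.
have lim1 : F (m + n.+1%:R) - F (m - n.+1%:R) @[n --> \oo] --> \int[mu]_x G x.
  by under eq_fun do rewrite -e; exact: cvg_Rintegral_itv.
(* At distance [n + 1] from [m], [|psi|] is at most [2 A (n + 1)] and the density at most
   [2 s^2 / (n + 1)^2] times its peak. *)
have bF n (x : R) : `|x - m| = n.+1%:R ->
    `|F x| <= (4 * A * normal_peak s * s ^+ 2) * n.+1%:R^-1.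
  move=> xn; have n0 : 0 < n.+1%:R :> R by rewrite ltr0n.
  have xm : x != m by rewrite -subr_eq0 -normr_eq0 xn gt_eqF.
  have A0 : 0 <= A.
    by have := le_trans (normr_ge0 _) (psiA x); rewrite pmulr_lge0// xn addr_gt0.
  rewrite normrM (ger0_norm (normal_pdf_ge0 _ _ _)).
  have h1 : `|psi x| <= A * (2 * n.+1%:R).
    rewrite (le_trans (psiA x))// xn ler_wpM2l//.
    have : 1 <= n.+1%:R :> R by rewrite ler1n.
    lra.
  have h2 := normal_pdf_le s0 xm.
  have := ler_pM (normr_ge0 _) (normal_pdf_ge0 m s x) h1 h2.
  rewrite -(real_normK (num_real (x - m))) xn => /le_trans; apply.
  rewrite le_eqVlt; apply/orP; left; apply/eqP; field.
  by rewrite gt_eqF.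
have lim2 : F (m + n.+1%:R) - F (m - n.+1%:R) @[n --> \oo] --> (0 : R).
  rewrite -[X in _ --> X](subr0 (0 : R)).
  have lim0 : (4 * A * normal_peak s * s ^+ 2) * n.+1%:R^-1 @[n --> \oo] --> (0 : R).
    rewrite -(mulr0 (4 * A * normal_peak s * s ^+ 2)).
    by apply: cvgM; [exact: cvg_cst|exact: cvg_harmonic].
  apply: cvgB; apply: norm_cvg0; apply: (@squeeze_cvgr _ _ _ _ (fun=> 0) _ _ _ _ _ lim0).
  - apply: nearW => n; rewrite normr_ge0/=; apply: bF.
    by rewrite addrAC subrr add0r ger0_norm.
  - exact: cvg_cst.
  - apply: nearW => n; rewrite normr_ge0/=; apply: bF.
    by rewrite addrAC subrr add0r normrN ger0_norm.
  - exact: cvg_cst.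
have : \int[mu]_x G x = 0 by apply: (@cvg_unique _ (@Rhausdorff R) _ _ _ _ lim1 lim2).
rewrite /G RintegralB//; last exact: integrableRZ.
rewrite RintegralZl// => /eqP; rewrite subr_eq0 => /eqP ->.
by rewrite mulrA divff// mul1r.
Qed.

End normal_density_integrals.

Lemma Rintegral_prob_cst d (T : measurableType d) (R : realType)
  (P : probability T R) (c : R) : \int[P]_w c = c.
Proof.
rewrite Rintegral_cst// -[RHS]mulr1; congr (c * _).
exact: (congr1 fine (@probability_setT _ _ _ P)).
Qed.

Section gaussian_moments.
Context d (T : measurableType d) (R : realType) (P : probability T R).
Variables (X : T -> R).
Hypothesis mX : measurable_fun setT X.
Local Notation mu := (@lebesgue_measure R).

Lemma transfer_pushforward (nu : {measure set (measurableTypeR R) -> \bar R}) (f : R -> R) :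
  (forall A : set R, measurable A -> pushforward P X A = nu A) ->
  measurable_fun setT f -> P.-integrable setT (EFin \o (f \o X)) ->
  nu.-integrable setT (EFin \o f) /\
  \int[P]_w f (X w) = \int[nu]_x f x.
Proof.
move=> Pnu mf fXi; have mX' : @measurable_fun _ _ T (measurableTypeR R) setT X by [].
have mEf : measurable_fun [set: measurableTypeR R] (EFin \o f) by exact/measurable_EFinP.
have e (g : R -> \bar R) : (\int[pushforward P (X : T -> measurableTypeR R)]_x g x
    = \int[nu]_x g x)%E.
  by apply: eq_measure_integral => A mA _; exact: Pnu.
have i1 := @integrable_pushforward _ _ T (measurableTypeR R) R X mX' P setT (EFin \o f) mEf fXi measurableT.
have i2 := @integral_pushforward _ _ T (measurableTypeR R) R X mX' P setT (EFin \o f) mEf fXi measurableT.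
split.
  have /integrableP[_ h] := i1; apply/integrableP; split => //.
  by rewrite -e.
by congr fine; rewrite -e i2 preimage_setT.
Qed.

(** The parameters [m] and [s] are chosen before the test functions, so that particular tests can
    identify them later. *)
Lemma gaussian_stein : gaussian_rv P X -> P.-integrable setT (EFin \o (fun w => X w ^+ 2)) ->
  exists m s : R, forall (A : R) (psi psi' : R -> R),
    (forall x : R, is_derive x 1 psi (psi' x)) -> continuous psi' ->
    (forall x, `|psi x| <= A * (1 + `|x - m|)) -> (forall x, `|psi' x| <= A) ->
    \int[P]_w ((X w - m) * psi (X w)) = s ^+ 2 * \int[P]_w psi' (X w).
Proof.
move=> [m [s PX]] X2; exists m, s => A psi psi' dpsi cpsi' psiA psiA'.
have A0 : 0 <= A by rewrite (le_trans _ (psiA' 0)).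
have cpsi : continuous psi.
  by move=> x; apply: differentiable_continuous; apply/derivable1_diffP; exact: ex_derive.
have mpsi : measurable_fun setT psi by exact: continuous_measurable_fun.
have mpsi' : measurable_fun setT psi' by exact: continuous_measurable_fun.
have mXpsi : measurable_fun setT (fun x : R => (x - m) * psi x).
  by apply: measurable_funM => //; exact: measurable_funB.
have i1 : P.-integrable setT (EFin \o (psi' \o X)).
  apply: (@le_integrableR _ _ _ P setT measurableT _ (fun=> A)) => //.
  - exact: measurableT_comp.
  - by move=> w _; exact: psiA'.
  - exact: finite_measure_integrable_cst.
have i2 : P.-integrable setT (EFin \o ((fun x : R => (x - m) * psi x) \o X)).
  apply: (@le_integrableR _ _ _ P setT measurableT _
     (fun w => A * (3 * X w ^+ 2 + (3 * m ^+ 2 + 1)))) => //.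
  - exact: (measurableT_comp mXpsi mX).
  - move=> w _ /=; rewrite normrM mulrC.
    apply: (@le_trans _ _ (A * (1 + `|X w - m|) * `|X w - m|)).
      by rewrite ler_wpM2r.
    rewrite -mulrA ler_wpM2l//; have := sqr_ge0 (`|X w - m| - 1).
    have := real_normK (num_real (X w - m)); have := sqr_ge0 (X w + m); nra.
  - apply: integrableRZ => //; apply: integrableRD => //; first exact: integrableRZ.
    exact: finite_measure_integrable_cst.
(* The degenerate clause of [gaussian_rv]: the law is a Dirac mass at [m] and both sides vanish. *)
have [s0|s0] := eqVneq s 0.
  have Pd (B : set R) : measurable B -> pushforward P X B = @dirac _ (measurableTypeR R) m R B.
    by move=> mB; rewrite PX// s0 eqxx.
  have [_ ->] := @transfer_pushforward (@dirac _ (measurableTypeR R) m R) _ Pd mXpsi i2.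
  rewrite s0 expr0n mul0r /Rintegral integral_dirac//; last exact/measurable_EFinP.
  by rewrite subrr mul0r mule0.
have Pn (B : set R) : measurable B -> pushforward P X B = normal_prob m s B.
  by move=> mB; rewrite PX// (negbTE s0).
have [j1 e1] := transfer_pushforward Pn mpsi' i1.
have [j2 e2] := transfer_pushforward Pn mXpsi i2.
rewrite [LHS]e2 e1 /Rintegral !integral_normal_prob//.
apply: (normal_stein s0 dpsi cpsi' psiA).
  exact: integrable_normal_prob.
exact: integrable_normal_prob.
Qed.

End gaussian_moments.

Section gaussian_characteristic_function.
Context d (T : measurableType d) (R : realType) (P : probability T R).
Variables (X : T -> R).
Hypothesis mX : measurable_fun setT X.
Hypothesis gX : gaussian_rv P X.
Hypothesis X2 : P.-integrable setT (EFin \o (fun w => X w ^+ 2)).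
Hypothesis X0 : \int[P]_w X w = 0.
Let v := \int[P]_w (X w ^+ 2).

Lemma integrable_of_sqr : P.-integrable setT (EFin \o X).
Proof.
apply: (@le_integrableR _ _ _ P setT measurableT _ (fun w => 1 + X w ^+ 2)) => //.
  move=> w _; have := real_normK (num_real (X w)); have := sqr_ge0 (`|X w| - 1).
  have := normr_ge0 (X w); nra.
by apply: integrableRD => //; exact: finite_measure_integrable_cst.
Qed.

(** Testing with [psi = 1] gives [m = 0], and then [psi = id] gives [s^2 = v]; no moment of the
    normal law is computed. *)
Lemma centered_gaussian_stein (A : R) (psi psi' : R -> R) :
    (forall x : R, is_derive x 1 psi (psi' x)) -> continuous psi' ->
    (forall x, `|psi x| <= A * (1 + `|x|)) -> (forall x, `|psi' x| <= A) ->
    \int[P]_w (X w * psi (X w)) = v * \int[P]_w psi' (X w).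
Proof.
have [m [s h]] := gaussian_stein mX gX X2.
have iX := integrable_of_sqr.
have m0 : m = 0.
  have e : \int[P]_w ((X w - m) * 1) = - m.
    under eq_Rintegral do rewrite mulr1.
    rewrite RintegralB//; last exact: finite_measure_integrable_cst.
    by rewrite X0 Rintegral_prob_cst sub0r.
  have := h 1 (fun=> 1) (fun=> 0) _ _ _ _.
  rewrite e Rintegral_prob_cst mulr0 => h0.
  apply/eqP; rewrite -oppr_eq0; apply/eqP; apply: h0.
  - by move=> x; exact: cvg_cst.
  - by move=> x; rewrite normr1 mul1r lerDl.
  - by move=> x; rewrite normr0.
rewrite m0 in h.
have sv : s ^+ 2 = v.
  have := h 1 id (fun=> 1) _ _ _ _.
  rewrite Rintegral_prob_cst !mulr1 => <-.
  - by apply: eq_Rintegral => w _; rewrite subr0 expr2.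
  - by move=> x; exact: cvg_cst.
  - by move=> x; rewrite subr0 mul1r lerDr.
  - by move=> x; rewrite normr1.
move=> dpsi cpsi psiA psiA'; rewrite -sv -(h A psi psi' dpsi cpsi)//.
  by apply: eq_Rintegral => w _; rewrite subr0.
by move=> x; rewrite subr0.
Qed.

Let is_derive_scale (a x : R) : is_derive x 1 (fun y : R => a * y) a.
Proof.
apply: (@is_derive_eq _ _ _ _ _ _ _ _ (@is_deriveZ _ _ _ id a _ _ _ (is_derive_id x 1))).
by rewrite /GRing.scale/= mulr1.
Qed.

Let integrable_bounded_comp (h : R -> R) (a : R) : continuous h ->
  (forall x, `|h x| <= 1) -> P.-integrable setT (EFin \o (fun w => h (a * X w))).
Proof.
move=> ch h1; apply: (@le_integrableR _ _ _ P setT measurableT _ (fun=> 1)) => //.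
  apply: (@measurableT_comp _ _ _ _ _ _ h); first exact: continuous_measurable_fun.
  exact: measurable_funM.
exact: finite_measure_integrable_cst.
Qed.

(* [E h(a X)] solves [y' = - v a y], by Stein's identity applied to [h'(a x)]. *)
Lemma gaussian_trig (h h' : R -> R) :
  (forall x : R, is_derive x 1 h (h' x)) -> (forall x : R, is_derive x 1 h' (- h x)) ->
  (forall x, `|h x| <= 1) -> (forall x, `|h' x| <= 1) ->
  \int[P]_w h (X w) = h 0 * expR (- (v / 2)).
Proof.
move=> dh dh' h1 h1'.
have ch : continuous h.
  by move=> x; apply: differentiable_continuous; apply/derivable1_diffP; exact: ex_derive.
have ch' : continuous h'.
  by move=> x; apply: differentiable_continuous; apply/derivable1_diffP; exact: ex_derive.
pose F (a : R) := \int[P]_w h (a * X w).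
have dF (a : R) : is_derive a 1 F (- v * a * F a).
  have der (x : R) w : is_derive x 1 (fun y : R => h (y * X w)) (h' (x * X w) * X w).
    have dl : is_derive x 1 (fun y : R => y * X w) (X w).
      rewrite (_ : (fun y => _) = (fun y => X w * y)) //.
      by apply/funext => y; rewrite mulrC.
    exact: (is_derive1_comp (dh _) dl).
  have Ia : [set` `]a - 1, a + 1[] a by rewrite /= in_itv/= ltrBlDr ltrDl ltr01.
  have intf (x : R) : [set` `]a - 1, a + 1[] x -> P.-integrable setT (EFin \o (fun w => h (x * X w))).
    by move=> _; exact: integrable_bounded_comp.
  have derf1 (x : R) w : [set` `]a - 1, a + 1[] x -> setT w -> derivable (fun y : R => h (y * X w)) x 1.
    by move=> _ _; exact: ex_derive.
  have G0 w : 0 <= `|X w| by [].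
  have intG : P.-integrable setT (EFin \o (fun w => `|X w|)).
    by apply: integrable_norm; exact: integrable_of_sqr.
  have Gub (x : R) w : [set` `]a - 1, a + 1[] x -> setT w ->
     `|partial1of2 (fun (x : R) w => h (x * X w)) x w| <= `|X w|.
    move=> _ _; rewrite partial1of2E (@derive_val _ _ _ _ _ _ _ (der x w)).
    by rewrite normrM ler_piMl.
  apply: DeriveDef.
    exact: (@derivable_under_integral _ _ _ P (fun (x : R) w => h (x * X w)) setT measurableT a _ _ Ia intf derf1 _ G0 intG Gub).
  rewrite -derive1E (@differentiation_under_integral _ _ _ P (fun (x : R) w => h (x * X w)) setT measurableT a _ _ Ia intf derf1 _ G0 intG Gub).
  have -> : (fun w => partial1of2 (fun (x : R) w0 => h (x * X w0)) a w) =
     (fun w => X w * h' (a * X w)).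
    by apply/funext => w; rewrite partial1of2E (@derive_val _ _ _ _ _ _ _ (der a w)) mulrC.
  have p1 (x : R) : is_derive x 1 (fun x => h' (a * x)) (a * - h (a * x)).
    rewrite mulrC; exact: (is_derive1_comp (dh' _) (is_derive_scale a x)).
  have p2 : continuous (fun x : R => a * - h (a * x)).
    move=> x; apply: cvgM; first exact: cvg_cst.
    apply: cvgN; apply: (cvg_comp (fun x : R => a * x) h); last exact: ch.
    by apply: cvgM; [exact: cvg_cst|exact: cvg_id].
  have p3 (x : R) : `|h' (a * x)| <= (1 + `|a|) * (1 + `|x|).
    rewrite (le_trans (h1' _))//; have := normr_ge0 a; have := normr_ge0 x.
    by have := mulr_ge0 (normr_ge0 a) (normr_ge0 x); nra.
  have p4 (x : R) : `|a * - h (a * x)| <= 1 + `|a|.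
    rewrite normrM normrN; have := h1 (a * x); have := normr_ge0 a.
    have := normr_ge0 (h (a * x)); nra.
  rewrite (centered_gaussian_stein p1 p2 p3 p4) /F.
  rewrite (_ : (fun w => a * - h (a * X w)) = (fun w => - a * h (a * X w))).
    by rewrite RintegralZl//; [ring|exact: integrable_bounded_comp].
  by apply/funext => w; ring.
pose Psi (a : R) := F a * expR (v / 2 * a ^+ 2).
have dPsi (a : R) : is_derive a 1 Psi 0.
  have de : is_derive a 1 (fun a : R => v / 2 * a ^+ 2) (v * a).
    have := @is_deriveZ _ _ _ _ (v / 2) _ _ _ (@is_deriveX _ _ id 2 a 1 _ (is_derive_id a 1)).
    move=> /is_derive_eq; apply.
    by rewrite /GRing.scale/= expr1 mulr1; field.
  have := is_deriveM (dF a) (is_derive1_comp (is_derive_expR _) de).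
  move=> /is_derive_eq; apply.
  by rewrite /GRing.scale/=; ring.
have := is_derive_0_is_cst 1 0 dPsi.
rewrite /Psi expr0n mulr0 expR0 mulr1 expr1n mulr1.
have -> : F 0 = h 0.
  rewrite /F (_ : (fun w => _) = (fun=> h 0)); last by apply/funext => w; rewrite mul0r.
  by rewrite Rintegral_prob_cst.
have -> : F 1 = \int[P]_w h (X w) by apply: eq_Rintegral => w _; rewrite mul1r.
by move=> <-; rewrite -mulrA -expRD subrr expR0 mulr1.
Qed.

Lemma gaussian_cos : \int[P]_w cos (X w) = expR (- (v / 2)).
Proof.
rewrite (@gaussian_trig cos (fun x => - sin x)) ?cos0 ?mul1r//.
- exact: cos_max.
- by move=> x; rewrite normrN sin_max.
Qed.

Lemma gaussian_sin : \int[P]_w sin (X w) = 0.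
Proof.
rewrite (@gaussian_trig sin cos) ?sin0 ?mul0r//.
- exact: sin_max.
- exact: cos_max.
Qed.

End gaussian_characteristic_function.

(** * Orthogonality to trigonometric functions *)

(** The derivative of [sin] at [0] along [x / (n + 1)]. It recovers an unbounded variable from
    bounded trigonometric functions of its multiples. *)
Lemma cvg_scaled_sin (R : realType) (x : R) :
  n.+1%:R * sin (n.+1%:R^-1 * x) @[n --> \oo] --> x.
Proof.
have [->|x0] := eqVneq x 0.
  by under eq_fun do rewrite mulr0 sin0 mulr0; exact: cvg_cst.
have ds := @is_derive_sin R 0.
have /cvg_ex[l hl] : derivable (@sin R) 0 1 by exact: ex_derive.
have l1 : l = 1.
  have <- : 'D_1 (@sin R) 0 = 1 by rewrite derive_val cos0.
  by apply/esym/cvg_lim.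
have := hl => /cvgr_dnbhsP /(_ (fun n => n.+1%:R^-1 * x)).
rewrite l1 => h.
have hs : (forall n : nat, n.+1%:R^-1 * x != 0) /\ n.+1%:R^-1 * x @[n --> \oo] --> (0 : R).
  split=> [n|]; first by rewrite mulf_neq0.
  by rewrite -(mul0r x); apply: cvgM; [exact: cvg_harmonic|exact: cvg_cst].
have {}h : sin (n.+1%:R^-1 * x) / (n.+1%:R^-1 * x) @[n --> \oo] --> (1 : R).
  apply: cvg_trans (h hs); apply: near_eq_cvg; apply: nearW => n.
  by rewrite /= /GRing.scale/= mulr1 addr0 sin0 subr0 mulrC.
have hc : sin (n.+1%:R^-1 * x) / (n.+1%:R^-1 * x) * x @[n --> \oo] --> 1 * x.
  by apply: cvgM; [exact: h|exact: cvg_cst].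
rewrite mul1r in hc; apply: cvg_trans hc; apply: near_eq_cvg.
apply: nearW => n /=; rewrite invfM invrK mulrA mulfVK//; exact: mulrC.
Qed.

Section trigonometric_test_functions.
Context d (T : measurableType d) (R : realType) (P : probability T R).
(* [M] is a linear space of random variables and [zeta] is orthogonal to
   [cos eta] and [sin eta] for every [eta] in [M]. *)
Variables (M : set (T -> R)) (zeta : T -> R).
Hypothesis M0 : M (fun=> 0).
Hypothesis MB : forall f g, M f -> M g -> M (fun w => f w - g w).
Hypothesis MZ : forall (a : R) f, M f -> M (fun w => a * f w).
Hypothesis mM : forall f, M f -> measurable_fun setT f.
Hypothesis izeta : P.-integrable setT (EFin \o zeta).
Hypothesis zeta_cos : forall f, M f -> \int[P]_w (zeta w * cos (f w)) = 0.
Hypothesis zeta_sin : forall f, M f -> \int[P]_w (zeta w * sin (f w)) = 0.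

Let MD f g : M f -> M g -> M (fun w => f w + g w).
Proof.
move=> Mf Mg; have := MB Mf (MB M0 Mg).
by rewrite (_ : (fun w => _) = (fun w => f w + g w))//; apply/funext => w; rewrite sub0r opprK.
Qed.

Let bounded (h : T -> R) := exists C : R, forall w, `|h w| <= C.

Let mbounded (h : T -> R) := measurable_fun setT h /\ bounded h.

Let mbM g h : mbounded g -> mbounded h -> mbounded (fun w => g w * h w).
Proof.
move=> [mg [C gC]] [mh [D hD]]; split; first exact: measurable_funM.
by exists (C * D) => w; rewrite normrM ler_pM.
Qed.

Let mbD g h : mbounded g -> mbounded h -> mbounded (fun w => g w + h w).
Proof.
move=> [mg [C gC]] [mh [D hD]]; split; first exact: measurable_funD.
by exists (C + D) => w; rewrite (le_trans (ler_normD _ _))// lerD.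
Qed.

Let mb_cst (c : R) : mbounded (fun=> c).
Proof. by split=> //; exists `|c|. Qed.

Let mb_cos f : M f -> mbounded (fun w => cos (f w)).
Proof.
move=> Mf; split; last by exists 1 => w; exact: cos_max.
apply: (@measurableT_comp _ _ _ _ _ _ (@cos R)); last exact: mM.
exact: continuous_measurable_fun (@continuous_cos R).
Qed.

Let mb_sin f : M f -> mbounded (fun w => sin (f w)).
Proof.
move=> Mf; split; last by exists 1 => w; exact: sin_max.
apply: (@measurableT_comp _ _ _ _ _ _ (@sin R)); last exact: mM.
exact: continuous_measurable_fun (@continuous_sin R).
Qed.

Let izM h : mbounded h -> P.-integrable setT (EFin \o (fun w => zeta w * h w)).
Proof.
move=> [mh [C hC]]; have mz : measurable_fun setT zeta by apply/measurable_EFinP; exact: measurable_int izeta.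
apply: (@le_integrableR _ _ _ P setT measurableT _ (fun w => C * `|zeta w|)).
- exact: measurable_funM.
- by move=> w _; rewrite normrM mulrC ler_wpM2r.
- by apply: integrableRZ => //; exact: integrable_norm.
Qed.

Let bounded_cvg (h_ : nat -> T -> R) (h : T -> R) (C : R) :
  (forall n, measurable_fun setT (h_ n)) -> (forall n w, `|h_ n w| <= C) ->
  (forall w, h_ n w @[n --> \oo] --> h w) ->
  mbounded h /\
  \int[P]_w (zeta w * h_ n w) @[n --> \oo] --> \int[P]_w (zeta w * h w).
Proof.
move=> mh hC hcv.
have mh' : measurable_fun setT h.
  by apply: (measurable_fun_cvg mh) => w _; exact: hcv.
have bh w : `|h w| <= C.
  apply: (@cvgr_to_le _ _ _ _ _ _ _ (cvg_norm (hcv w))).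
  by apply: nearW => n; exact: hC.
have mz : measurable_fun setT zeta by apply/measurable_EFinP; exact: measurable_int izeta.
split; first by split=> //; exists C.
have iz : P.-integrable setT (EFin \o (fun w => zeta w * h w)).
  by apply: izM; split=> //; exists C.
apply: fine_cvg; rewrite fineK; last exact: integrable_fin_num.
apply: (@dominated_cvg _ _ _ P setT measurableT _ _ (EFin \o (fun w => C * `|zeta w|))) => //.
- by move=> n; apply/measurable_EFinP; exact: measurable_funM.
- move=> w _; apply: cvg_EFin; first exact: nearW.
  by apply: cvgM; [exact: cvg_cst|exact: hcv].
- by apply: integrableRZ => //; exact: integrable_norm.
- by move=> n w _; rewrite /= lee_fin normrM mulrC ler_wpM2r.
Qed.

(** The weights [h] for which [zeta * h] keeps the orthogonality assumed of [zeta]. They form a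
    linear space with no evident products; their multipliers, defined next, are closed under
    products by composition. *)
Let orth (h : T -> R) := mbounded h /\ forall f, M f ->
  \int[P]_w (zeta w * (h w * cos (f w))) = 0 /\
  \int[P]_w (zeta w * (h w * sin (f w))) = 0.

(* The class [mult] is closed under bounded limits and, by product-to-sum,
   contains the [sin (f w)]; the sets with indicator in [mult] therefore form a
   sigma-algebra, which makes every [f = lim n sin (f / n)] measurable. *)
Let mult (g : T -> R) := mbounded g /\ forall h, orth h -> orth (fun w => g w * h w).

Let orth_lim (h_ : nat -> T -> R) h (C : R) : (forall n, orth (h_ n)) ->
  (forall n w, `|h_ n w| <= C) -> (forall w, h_ n w @[n --> \oo] --> h w) -> orth h.
Proof.
move=> oh hC hcv.
have [mbh _] := bounded_cvg (fun n => (oh n).1.1) hC hcv.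
split=> // f Mf.
have lim0 (t : R -> R) : mbounded (fun w => t (f w)) -> (forall w, `|t (f w)| <= 1) ->
    (forall n, \int[P]_w (zeta w * (h_ n w * t (f w))) = 0) ->
    \int[P]_w (zeta w * (h w * t (f w))) = 0.
  move=> mbt t1 e0.
  have hb n w : `|h_ n w * t (f w)| <= C by rewrite normrM -[C]mulr1 ler_pM.
  have hl w : h_ n w * t (f w) @[n --> \oo] --> h w * t (f w).
    by apply: cvgM; [exact: hcv|exact: cvg_cst].
  have [_ c] := bounded_cvg (fun n => (mbM (oh n).1 mbt).1) hb hl.
  apply: (@cvg_unique _ (@Rhausdorff R) _ _ _ _ c).
  by rewrite /=; under eq_fun do rewrite e0; exact: cvg_cst.
split.
  by apply: (lim0 cos (mb_cos Mf)) => [w|n]; [exact: cos_max|exact: ((oh n).2 f Mf).1].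
by apply: (lim0 sin (mb_sin Mf)) => [w|n]; [exact: sin_max|exact: ((oh n).2 f Mf).2].
Qed.

Let mult_lim (g_ : nat -> T -> R) g (C : R) : (forall n, mult (g_ n)) ->
  (forall n w, `|g_ n w| <= C) -> (forall w, g_ n w @[n --> \oo] --> g w) -> mult g.
Proof.
move=> mg gC gcv; have [mbg _] := bounded_cvg (fun n => (mg n).1.1) gC gcv.
split=> // h oh; have [D hD] := oh.1.2.
apply: (@orth_lim (fun n w => g_ n w * h w) _ (C * D)).
- by move=> n; apply: (mg n).2.
- by move=> n w; rewrite normrM ler_pM.
- by move=> w; apply: cvgM; [exact: gcv|exact: cvg_cst].
Qed.

Let multM g1 g2 : mult g1 -> mult g2 -> mult (fun w => g1 w * g2 w).
Proof.
move=> [b1 m1] [b2 m2]; split; first exact: mbM.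
move=> h oh; rewrite (_ : (fun w => _) = (fun w => g1 w * (g2 w * h w))).
  exact/m1/m2.
by apply/funext => w; rewrite mulrA.
Qed.

Let orth_lin (a b : R) h1 h2 : orth h1 -> orth h2 -> orth (fun w => a * h1 w + b * h2 w).
Proof.
move=> [b1 o1] [b2 o2]; split.
  by apply: mbD; apply: mbM => //; exact: mb_cst.
move=> f Mf; have [c1 s1] := o1 f Mf; have [c2 s2] := o2 f Mf.
have lin0 (t : R -> R) : mbounded (fun w => t (f w)) ->
    \int[P]_w (zeta w * (h1 w * t (f w))) = 0 ->
    \int[P]_w (zeta w * (h2 w * t (f w))) = 0 ->
    \int[P]_w (zeta w * ((a * h1 w + b * h2 w) * t (f w))) = 0.
  move=> mbt e1 e2.
  rewrite (_ : (fun w => _) = (fun w => a * (zeta w * (h1 w * t (f w))) +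
     b * (zeta w * (h2 w * t (f w))))); last by apply/funext => w; ring.
  have i1 := izM (mbM b1 mbt); have i2 := izM (mbM b2 mbt).
  rewrite RintegralD//; [|exact: integrableRZ..].
  by rewrite !RintegralZl// e1 e2 !mulr0 addr0.
by split; apply: lin0 => //; [exact: mb_cos|exact: mb_sin].
Qed.

Let multD (a b : R) g1 g2 : mult g1 -> mult g2 -> mult (fun w => a * g1 w + b * g2 w).
Proof.
move=> [b1 m1] [b2 m2]; split.
  by apply: mbD; apply: mbM => //; exact: mb_cst.
move=> h oh; have := orth_lin a b (m1 h oh) (m2 h oh).
by rewrite (_ : (fun w => _) = (fun w => (a * g1 w + b * g2 w) * h w))//; apply/funext => w; ring.
Qed.

Let mult_cst (c : R) : mult (fun=> c).
Proof.
split; first exact: mb_cst.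
move=> h oh; have := orth_lin c 0 oh oh.
by rewrite (_ : (fun w => _) = (fun w => c * h w))//; apply/funext => w; rewrite mul0r addr0.
Qed.

Let orth1 : orth (fun=> 1).
Proof.
split; first exact: mb_cst.
move=> f Mf; rewrite -[X in _ = X /\ _](zeta_cos Mf) -[X in _ /\ _ = X](zeta_sin Mf).
by split; apply: eq_Rintegral => w _; rewrite mul1r.
Qed.

Let mult_sin f : M f -> mult (fun w => sin (f w)).
Proof.
move=> Mf; split; first exact: mb_sin.
move=> h [bh oh]; split; first by apply: mbM => //; exact: mb_sin.
move=> f' Mf'; have [cD sD] := oh _ (MD Mf Mf'); have [cB sB] := oh _ (MB Mf Mf').
have iD := izM (mbM bh (mb_sin (MD Mf Mf'))).
have iB := izM (mbM bh (mb_sin (MB Mf Mf'))).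
have jD := izM (mbM bh (mb_cos (MD Mf Mf'))).
have jB := izM (mbM bh (mb_cos (MB Mf Mf'))).
split.
  rewrite (_ : (fun w => _) = (fun w => 2^-1 * (zeta w * (h w * sin (f w + f' w))
     + zeta w * (h w * sin (f w - f' w))))).
    by rewrite RintegralZl ?RintegralD ?sD ?sB ?addr0 ?mulr0//; exact: integrableRD.
  by apply/funext => w; rewrite sinD sinB; field.
rewrite (_ : (fun w => _) = (fun w => 2^-1 * (zeta w * (h w * cos (f w - f' w))
   - zeta w * (h w * cos (f w + f' w))))).
  by rewrite RintegralZl ?RintegralB ?cD ?cB ?subr0 ?mulr0//; exact: integrableRB.
by apply/funext => w; rewrite cosB cosD; field.
Qed.

(** The partial sums of the series are polynomials in [g], bounded by [e^C] when [|g| <= C], so the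
    bounded limit applies. *)
Let mult_expR g : mult g -> mult (fun w => expR (g w)).
Proof.
move=> mg; have [C gC] := mg.1.2.
apply: (@mult_lim (fun n w => series (exp_coeff (g w)) n) _ (expR C)).
- elim=> [|n ih]; first by rewrite (_ : (fun w => _) = (fun=> 0)) //; apply/funext => w; rewrite /series/= big_geq.
  have mX : mult (fun w => g w ^+ n).
    elim: n {ih} => [|n ih]; first exact: mult_cst.
    by rewrite (_ : (fun w => _) = (fun w => g w * g w ^+ n)); [exact: multM|apply/funext => w; rewrite exprS].
  rewrite (_ : (fun w => _) = (fun w => 1 * series (exp_coeff (g w)) n + n`!%:R^-1 * g w ^+ n)).
    exact: multD.
  by apply/funext => w; rewrite /series/= big_nat_recr//= /exp_coeff/= mul1r mulrC.
- move=> n w; apply: (@le_trans _ _ (expR `|g w|)); last by rewrite ler_expR.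
  rewrite /series/= (le_trans (ler_norm_sum _ _ _))//.
  have := @is_cvg_series_exp_coeff R `|g w|.
  have nd : nondecreasing_seq (series (exp_coeff `|g w|)).
    by apply: nondecreasing_series => k _ _; rewrite /exp_coeff/= divr_ge0 ?exprn_ge0.
  move=> /(nondecreasing_cvgn_le nd)/(_ n); apply: le_trans.
  rewrite /series/=; apply: ler_sum => k _.
  by rewrite /exp_coeff/= normrM normrX normfV normr_nat.
- by move=> w; exact: is_cvg_series_exp_coeff.
Qed.

(* [exp (- n e^(n (g - c)))] tends to [\1_(g < c)], also where [g = c]. *)
Let mult_lt g c : mult g -> mult (\1_[set w | g w < c]).
Proof.
move=> mg; pose e (n : nat) w := expR (- n%:R * expR (n%:R * (g w - c))).
have me n : mult (e n).
  apply: mult_expR.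
  have m1 : mult (fun w => expR (n%:R * (g w - c))).
    apply: mult_expR; have := multD n%:R (- n%:R * c) mg (mult_cst 1).
    by rewrite (_ : (fun w => _) = (fun w => n%:R * (g w - c)))//; apply/funext => w; ring.
  have := multD (- n%:R) 0 m1 (mult_cst 0).
  by rewrite (_ : (fun w => _) = (fun w => - n%:R * expR (n%:R * (g w - c))))//; apply/funext => w; ring.
apply: (mult_lim me (C := 1)) => [n w|w].
  by rewrite ger0_norm ?expR_ge0// expR_le1 mulNr oppr_le0 mulr_ge0 ?expR_ge0.
rewrite indicE; have [|] := boolP (w \in _); rewrite ?inE ?notin_setE/=.
  rewrite -subr_lt0; set x := g w - c => x0; rewrite -[true%:R]expR0.
  apply: (cvg_comp (fun n => - n%:R * expR (n%:R * x)) (@expR R)); last exact: continuous_expR.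
  suff L : n%:R * expR (n%:R * x) @[n --> \oo] --> (0 : R).
    rewrite -oppr0; apply: cvg_trans (cvgN L); apply: near_eq_cvg.
    by apply: nearW => n; rewrite /= mulNr.
  rewrite -(cvg_shiftS (fun n => n%:R * expR (n%:R * x))).
  have lim0 : (2 / x ^+ 2) * n.+1%:R^-1 @[n --> \oo] --> (0 : R).
    by rewrite -(mulr0 (2 / x ^+ 2)); apply: cvgM; [exact: cvg_cst|exact: cvg_harmonic].
  apply: (@squeeze_cvgr _ _ _ _ (fun=> 0) _ _ _ _ _ lim0); last exact: cvg_cst.
  apply: nearW => n; rewrite mulr_ge0 ?expR_ge0//=.
  have n0 : 0 < n.+1%:R :> R by rewrite ltr0n.
  (* The inequality [e^y >= 1 + y^2 / 2] at [y = - (n + 1) x] gives [(n + 1) e^((n + 1) x) <= 2 /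
     (x^2 (n + 1))]. *)
  have := @expR_ge1Dxn R (n.+1%:R * - x) 1.
  rewrite mulr_ge0 ?oppr_ge0 ?(ltW x0)// => /(_ isT) h.
  rewrite -[n.+1%:R * x]opprK -mulrN expRN.
  rewrite ler_pdivrMr ?expR_gt0//.
  have x2 : 0 < x ^+ 2 by rewrite exprn_even_gt0//= lt_eqF.
  have e2 : (2 / x ^+ 2 / n.+1%:R) * ((n.+1%:R * - x) ^+ 2 / 2`!%:R) = n.+1%:R.
    by rewrite (_ : 2`! = 2)//; field; rewrite gt_eqF//= -[x == 0]negbK lt_eqF.
  rewrite -[leLHS]e2 ler_wpM2l//; first by rewrite !mulr_ge0 ?invr_ge0 ?(ltW x2).
  by rewrite (le_trans _ h)// lerDr.
move/negP; rewrite -leNgt -subr_ge0 => x0.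
apply: (@squeeze_cvgr _ _ _ _ (fun=> 0) _ _ _ _ _ (@cvgn_expR R)); last exact: cvg_cst.
apply: nearW => n; rewrite expR_ge0/= ler_expR mulNr lerN2 ler_peMr//.
by rewrite -[leLHS]expR0 ler_expR mulr_ge0.
Qed.

Let msets : set (set T) := [set A | mult \1_A].

Let msets_setU A B : msets A -> msets B -> msets (A `|` B).
Proof.
rewrite /msets/= => mA mB; have := multD 1 (-1) (multD 1 1 mA mB) (multM mA mB).
rewrite (_ : (fun w => _) = \1_(A `|` B))//; apply/funext => w.
rewrite !indicE in_setU; case: (w \in A); case: (w \in B) => /=; ring.
Qed.

(** Products of multipliers give finite unions by inclusion-exclusion, so countable unions are
    bounded limits and no Dynkin class argument is required. *)
Let sigma_algebra_msets : sigma_algebra setT msets.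
Proof.
split.
- rewrite /msets/= (_ : \1_set0 = (fun=> 0)); first exact: mult_cst.
  by apply/funext => w; rewrite indicE in_set0.
- move=> A mA; have := multD 1 (-1) (mult_cst 1) mA.
  rewrite /msets/= (_ : (fun w => _) = \1_(setT `\` A))//; apply/funext => w.
  by rewrite !indicE setTD in_setC; case: (w \in A) => /=; ring.
- move=> A mA; have mU n : msets (\big[setU/set0]_(k < n) A k).
    elim: n => [|n ih]; last by rewrite big_ord_recr/=; exact: msets_setU.
    rewrite big_ord0 /msets/= (_ : \1_set0 = (fun=> 0)); first exact: mult_cst.
    by apply/funext => w; rewrite indicE in_set0.
  apply: (mult_lim mU (C := 1)) => [n w|w].
    by rewrite indicE; case: (w \in _); rewrite ?normr1 ?normr0.
  apply: cvg_near_cst; have [[k _ Akw]|nA] := pselect ((\bigcup_k A k) w).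
    exists k.+1 => // n /= kn; rewrite !indicE mem_set ?mem_set//; first by exists k.
    by rewrite -bigcup_mkord; exists k.
  apply: nearW => n; rewrite !indicE !memNset// => h; apply: nA.
  by move: h; rewrite -bigcup_mkord => -[k _ ?]; exists k.
Qed.

Let msets_preimage f (B : set R) : M f -> measurable B -> msets (f @^-1` B).
Proof.
move=> Mf mB.
have msg g : mult g -> @measurable_fun _ _ (g_sigma_algebraType msets) R setT g.
  move=> mg; apply: (measurability _ (RGenInftyO.measurableE R)).
  move=> _ [_ [x ->] <-]; rewrite setTI; apply: sub_sigma_algebra.
  rewrite (_ : _ @^-1` _ = [set w | g w < x]); first exact: mult_lt.
  by apply/seteqP; split=> w /=; rewrite in_itv.
have mf : @measurable_fun _ _ (g_sigma_algebraType msets) R setT f.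
  apply: (@measurable_fun_cvg _ (g_sigma_algebraType msets) _ _
     (fun n w => n.+1%:R * sin (n.+1%:R^-1 * f w))) => [n|w _].
    apply: msg; have := multD n.+1%:R 0 (mult_sin (MZ n.+1%:R^-1 Mf)) (mult_cst 0).
    by rewrite (_ : (fun w => _) = (fun w => n.+1%:R * sin (n.+1%:R^-1 * f w)))//; apply/funext => w; ring.
  exact: cvg_scaled_sin.
have := mf measurableT B mB; rewrite setTI.
by rewrite /measurable/= (sigma_algebra_id sigma_algebra_msets).
Qed.

(** The indicator of [A] is a multiplier; apply it to the weight [1] and test with [f = 0], where
    [cos] is [1]. This is applied to trigonometric functions of the prediction residual. *)
Lemma Rintegral_sigma_trig (G : set (set T)) :
  (forall A, G A -> exists f B, [/\ M f, measurable B & A = f @^-1` B]) ->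
  forall A, <<s G >> A -> \int[P]_(w in A) zeta w = 0.
Proof.
move=> hG A GA.
have : msets A.
  apply: GA; split; first exact: sigma_algebra_msets.
  by move=> B /hG[f [C [Mf mC ->]]]; exact: msets_preimage.
move=> [_ /(_ _ orth1)[_ /(_ _ M0)[+ _]]] => <-.
rewrite Rintegral_mkcond; apply: eq_Rintegral => w _.
by rewrite cos0 mulr1 mulr1 patchE indicE; case: (w \in A); rewrite ?mulr1 ?mulr0.
Qed.

End trigonometric_test_functions.

(** * Mean square limits *)

Section square_integrable.
Context d (T : measurableType d) (R : realType) (P : probability T R).
Implicit Types f g h : T -> R.

Definition sq_integrable f :=
  measurable_fun setT f /\ P.-integrable setT (EFin \o (fun w => f w ^+ 2)).

Lemma sq_integrableM f g : sq_integrable f -> sq_integrable g ->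
  P.-integrable setT (EFin \o (fun w => f w * g w)).
Proof.
move=> [mf if2] [mg ig2].
apply: (@le_integrableR _ _ _ P setT measurableT _ (fun w => f w ^+ 2 + g w ^+ 2)).
- exact: measurable_funM.
- move=> w _; have := sqr_ge0 (`|f w| - `|g w|); have := sqr_ge0 (`|f w| + `|g w|).
  rewrite normrM -(real_normK (num_real (f w))) -(real_normK (num_real (g w))); nra.
- exact: integrableRD.
Qed.

Lemma sq_integrable_cst (c : R) : sq_integrable (fun=> c).
Proof. by split=> //; exact: finite_measure_integrable_cst. Qed.

Lemma sq_integrable1 f : sq_integrable f -> P.-integrable setT (EFin \o f).
Proof.
move=> sf; have := sq_integrableM sf (sq_integrable_cst 1).
by rewrite (_ : (fun w => _) = f)//; apply/funext => w; rewrite mulr1.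
Qed.

Lemma sq_integrable_lin (a b : R) f g : sq_integrable f -> sq_integrable g ->
  sq_integrable (fun w => a * f w + b * g w).
Proof.
move=> sf sg; split.
  by apply: measurable_funD; apply: measurable_funM => //; [exact: sf.1|exact: sg.1].
rewrite (_ : (fun w => _) = (fun w => a ^+ 2 * f w ^+ 2 + b ^+ 2 * g w ^+ 2
   + 2 * a * b * (f w * g w))); last by apply/funext => w; ring.
apply: integrableRD => //; last by apply: integrableRZ => //; exact: sq_integrableM.
by apply: integrableRD => //; apply: integrableRZ => //; [exact: sf.2|exact: sg.2].
Qed.

Lemma sq_integrableB f g : sq_integrable f -> sq_integrable g ->
  sq_integrable (fun w => f w - g w).
Proof.
move=> sf sg; have := sq_integrable_lin 1 (-1) sf sg.
by rewrite (_ : (fun w => _) = (fun w => f w - g w))//; apply/funext => w; ring.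
Qed.

Lemma Rintegral_sqr_lin (a b : R) f g : sq_integrable f -> sq_integrable g ->
  \int[P]_w ((a * f w + b * g w) ^+ 2) = a ^+ 2 * (\int[P]_w (f w ^+ 2)) +
    b ^+ 2 * (\int[P]_w (g w ^+ 2)) + 2 * a * b * \int[P]_w (f w * g w).
Proof.
move=> sf sg; have if2 := sf.2; have ig2 := sg.2; have ifg := sq_integrableM sf sg.
rewrite (_ : (fun w => _) = (fun w => a ^+ 2 * f w ^+ 2 + b ^+ 2 * g w ^+ 2
   + 2 * a * b * (f w * g w))); last by apply/funext => w; ring.
rewrite RintegralD//; [|by apply: integrableRD => //; exact: integrableRZ|exact: integrableRZ].
by rewrite RintegralD ?RintegralZl//; exact: integrableRZ.
Qed.

(** Instead of Cauchy-Schwarz, integrate [2 |f| <= e + f^2 / e]. *)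
Lemma Rintegral_norm_le f (e : R) : 0 < e -> sq_integrable f ->
  \int[P]_w (f w ^+ 2) <= e ^+ 2 -> \int[P]_w `|f w| <= e.
Proof.
move=> e0 sf fe; have i1 := sq_integrable1 sf.
have i2 : P.-integrable setT (EFin \o (fun w => e^-1 * f w ^+ 2)).
  by apply: integrableRZ => //; exact: sf.2.
have i3 : P.-integrable setT (EFin \o (fun w => e)).
  exact: finite_measure_integrable_cst.
have i4 := integrableRD measurableT i3 i2.
apply: (@le_trans _ _ (\int[P]_w (2^-1 * (e + e^-1 * f w ^+ 2)))).
  apply: le_Rintegral => //; [exact: integrable_norm|exact: integrableRZ|].
  move=> w _; rewrite -(real_normK (num_real (f w))).
  have h : 0 <= e^-1 * (e - `|f w|) ^+ 2 by rewrite mulr_ge0 ?sqr_ge0// invr_ge0 ltW.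
  have e1 : e^-1 * (e - `|f w|) ^+ 2 = e - 2 * `|f w| + e^-1 * `|f w| ^+ 2.
    by field; rewrite gt_eqF.
  lra.
rewrite RintegralZl// RintegralD// RintegralZl//; last exact: sf.2.
rewrite Rintegral_cst//.
have -> : fine (P setT) = 1 by exact: (congr1 fine (@probability_setT _ _ _ P)).
have : e^-1 * (\int[P]_w (f w ^+ 2)) <= e.
  by rewrite ler_pdivrMl// -expr2.
lra.
Qed.

(* Riesz-Fischer for a sequence converging fast; the limit is measurable for
   any sub-sigma-algebra making the sequence measurable. *)
Lemma sq_integrable_limit (G : set (set T)) (m : nat -> T -> R) :
  sigma_algebra setT G -> (forall A, G A -> measurable A) ->
  (forall k (B : set R), measurable B -> G (m k @^-1` B)) ->
  (forall k, sq_integrable (m k)) ->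
  (forall k j, (k <= j)%N ->
    \int[P]_w ((m k w - m j w) ^+ 2) <= (2^-1 ^+ k) ^+ 2) ->
  exists Y : T -> R, [/\ forall B : set R, measurable B -> G (Y @^-1` B),
    sq_integrable Y &
    forall k, \int[P]_w ((m k w - Y w) ^+ 2) <= (2^-1 ^+ k) ^+ 2].
Proof.
move=> sG Gm mG sm cm.
have smB k j : sq_integrable (fun w => m k w - m j w) by exact: sq_integrableB.
pose u k w : \bar R := (`|m k w - m k.+1 w|)%:E.
have mu_ k : measurable_fun setT (u k).
  by apply/measurable_EFinP; apply: measurableT_comp => //; exact: (smB _ _).1.
have u0 k w : setT w -> (0 <= u k w)%E by move=> _; rewrite lee_fin.
have iu k : (\int[P]_w u k w <= (2^-1 ^+ k)%:E)%E.
  have ik : P.-integrable setT (EFin \o (fun w => `|m k w - m k.+1 w|)).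
    by apply: integrable_norm; exact: sq_integrable1.
  rewrite -[leLHS]fineK; last exact: integrable_fin_num.
  rewrite lee_fin; apply: Rintegral_norm_le => //.
  exact: cm.
have su : (\int[P]_w (\sum_(k <oo) u k w) < +oo)%E.
  rewrite integral_nneseries//.
  apply: (@le_lt_trans _ _ 2%:E); last by rewrite ltry.
  apply: lime_le; first by apply: is_cvg_nneseries => k _ _; apply: integral_ge0 => w _; exact: u0.
  apply: nearW => n; apply: (@le_trans _ _ (\sum_(0 <= k < n) (2^-1 ^+ k)%:E)%E).
    by apply: lee_sum => k _.
  rewrite sumEFin lee_fin.
  have -> : \sum_(0 <= k < n) 2^-1 ^+ k = 2 - 2 * 2^-1 ^+ n :> R.
    elim: n => [|n ih]; first by rewrite big_geq// expr0; lra.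
    by rewrite big_nat_recr//= ih exprS; field.
  by rewrite lerBlDr lerDl mulr_ge0// exprn_ge0// invr_ge0.
have msu : measurable_fun setT (fun w => \sum_(k <oo) u k w)%E.
  by apply: ge0_emeasurable_sum => // k w _ _; exact: u0.
have su0 w : (0 <= \sum_(k <oo) u k w)%E by apply: nneseries_ge0 => k _ _; exact: u0.
have isu : P.-integrable setT (fun w => \sum_(k <oo) u k w)%E.
  by apply/integrableP; split => //; under eq_integral do rewrite gee0_abs//.
have ae_cv : {ae P, forall w, cvgn (fun k => m k w)}.
  apply: filterS (integrable_ae measurableT isu) => w /(_ Logic.I) fin.
  have cs : cvgn (series (fun k => m k w - m k.+1 w)).
    apply: normed_cvg; apply: nondecreasing_is_cvgn.
      by apply: (@nondecreasing_series _ (fun k => `|m k w - m k.+1 w|) xpredT 0%N) => k _ _; exact: normr_ge0.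
    exists (fine (\sum_(k <oo) u k w)%E) => _ [n _ <-].
    rewrite -lee_fin fineK// /series/= -sumEFin.
    by apply: (@nneseries_lim_ge _ (fun k => u k w)) => *; exact: u0.
  have e k : m k w = m 0%N w - series (fun k => m k w - m k.+1 w) k.
    elim: k => [|k ih]; first by rewrite /series/= big_geq// subr0.
    by rewrite /series/= big_nat_recr//= opprD addrA -/(series _ k) -ih; ring.
  rewrite (_ : (fun k => m k w) = (fun k => m 0%N w - series (fun k => m k w - m k.+1 w) k)); last exact/funext.
  by apply: is_cvgB => //; exact: is_cvg_cst.
(* The upper limit exists everywhere and inherits measurability for [G], so no null set outside [G]
   has to be removed; [fine] sends infinite values to [0]. *)
pose Y w := fine (limn_esup (fun k => (m k w)%:E)).
have YE w : cvgn (fun k => m k w) -> m k w @[k --> \oo] --> Y w.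
  move=> cw; have cE : (m k w)%:E @[k --> \oo] --> (limn (fun k => m k w))%:E.
    by apply: cvg_EFin => //; exact: nearW.
  have eY : Y w = limn (fun k => m k w).
    by rewrite /Y is_cvg_limn_esupE; [rewrite (cvg_lim _ cE)|apply/cvg_ex; eexists; exact: cE].
  by rewrite eY.
have mY (B : set R) : measurable B -> G (Y @^-1` B).
  move=> mB; have mm k : @measurable_fun _ _ (g_sigma_algebraType G) R setT (m k).
    by move=> _ C mC; rewrite setTI; apply: sub_sigma_algebra; exact: mG.
  have mY : @measurable_fun _ _ (g_sigma_algebraType G) R setT Y.
    apply: (@measurableT_comp _ _ _ _ _ _ (@fine R)); first exact: fine_measurable.
    by apply: measurable_fun_limn_esup => k; exact/measurable_EFinP.
  have := mY measurableT B mB; rewrite setTI.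
  by rewrite /measurable/= (sigma_algebra_id sG).
have mYT : measurable_fun setT Y by move=> _ B mB; rewrite setTI; exact/Gm/mY.
have mB k : measurable_fun setT (fun w => m k w - Y w).
  by apply: measurable_funB => //; exact: (sm k).1.
(* Fatou's lemma in [j] carries the Cauchy bound over to the limit. *)
have fat k : (\int[P]_w ((m k w - Y w) ^+ 2)%:E <= ((2^-1 ^+ k) ^+ 2)%:E)%E.
  pose f j w : \bar R := ((m k w - m (k + j)%N w) ^+ 2)%:E.
  have mf j : measurable_fun setT (f j).
    by apply/measurable_EFinP; apply: measurable_funX; exact: (smB _ _).1.
  have f0 j w : setT w -> (0 <= f j w)%E by move=> _; rewrite lee_fin sqr_ge0.
  have := @fatou _ _ _ P setT measurableT f mf f0.
  rewrite (_ : (\int[P]_w limn_einf (f^~ w) = \int[P]_w ((m k w - Y w) ^+ 2)%:E)%E).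
    move=> /le_trans; apply; rewrite limn_einf_lim; apply: lime_le.
      exact: is_cvg_einfs.
    apply: nearW => j; apply: (@le_trans _ _ (\int[P]_w f j w)%E).
      by apply: ereal_inf_lbound; exists j => /=.
    rewrite -[leLHS]fineK; last by apply: integrable_fin_num => //; exact: (smB _ _).2.
    by rewrite lee_fin; apply: cm; rewrite leq_addr.
  apply: ge0_ae_eq_integral => //.
  - rewrite (_ : (fun w => _) = (fun w => - limn_esup (fun j => - f j w))%E).
      apply: measurableT_comp => //; apply: measurable_fun_limn_esup => j.
      exact: measurableT_comp.
    by apply/funext => w.
  - by apply/measurable_EFinP; exact: measurable_funX.
  - by move=> w _; rewrite limn_einf_lim; apply: lime_ge; [exact: is_cvg_einfs|apply: nearW => n; apply: le_ereal_inf_tmp => _ [j _ <-]; exact: f0].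
  - by move=> w _; rewrite lee_fin sqr_ge0.
  - apply: filterS ae_cv => w /YE cw _.
    have cf : f j w @[j --> \oo] --> ((m k w - Y w) ^+ 2)%:E.
      apply: cvg_EFin; first exact: nearW.
      apply: (cvg_comp (fun j => m k w - m (k + j)%N w) (fun x : R => x ^+ 2)); last exact: exprn_continuous.
      apply: cvgB; first exact: cvg_cst.
      have h : m (j + k)%N w @[j --> \oo] --> Y w by rewrite (cvg_shiftn k (fun j => m j w)).
      by apply: cvg_trans h; apply: near_eq_cvg; apply: nearW => j; rewrite addnC.
    rewrite is_cvg_limn_einfE; first exact: cvg_lim cf.
    by apply/cvg_ex; eexists; exact: cf.
have iY k : P.-integrable setT (EFin \o (fun w => (m k w - Y w) ^+ 2)).
  apply/integrableP; split; first by apply/measurable_EFinP; exact: measurable_funX.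
  apply: le_lt_trans (ltry ((2^-1 ^+ k) ^+ 2)); apply: le_trans (fat k).
  rewrite le_eqVlt; apply/orP; left; apply/eqP; apply: eq_integral => w _ /=.
  by rewrite ger0_norm ?sqr_ge0.
exists Y; split=> //.
  have := sq_integrableB (sm 0%N) (conj (mB 0%N) (iY 0%N)).
  by rewrite (_ : (fun w => _) = Y)//; apply/funext => w; rewrite opprB addrC subrK.
by move=> k; rewrite -lee_fin fineK; [exact: fat|exact: (integrable_fin_num measurableT (iY k))].
Qed.

End square_integrable.

(** * Lipschitz bounds and rescaled limits of sine and cosine *)

Section trig_bounds.
Context {R : realType}.
Implicit Types x y : R.

Lemma norm_sin_le x : `|sin x| <= `|x|.
Proof.
wlog x0 : x / 0 < x.
  move=> h; have [x0|x0|->] := ltgtP x 0; last by rewrite sin0.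
    by rewrite -normrN -sinN -[leRHS]normrN h// oppr_gt0.
  exact: h.
have [c _] := @MVT R sin cos _ _ x0 (fun x _ => is_derive_sin x)
  (continuous_subspaceT (@continuous_sin R)).
by rewrite sin0 !subr0 => ->; rewrite normrM ler_piMl// cos_max.
Qed.

Lemma cos_lip x y : `|cos x - cos y| <= `|x - y|.
Proof.
have -> : cos x - cos y = - 2 * sin ((x + y) / 2) * sin ((x - y) / 2).
  have -> : cos x = cos ((x + y) / 2 + (x - y) / 2) by congr cos; field.
  have -> : cos y = cos ((x + y) / 2 - (x - y) / 2) by congr cos; field.
  by rewrite cosD cosB; ring.
rewrite !normrM (_ : `|-2| = 2 :> R); last by rewrite normrN normr_nat.
rewrite -mulrA.
have h1 := sin_max ((x + y) / 2); have h2 := norm_sin_le ((x - y) / 2).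
rewrite normrM [`|2^-1|]ger0_norm ?invr_ge0// in h2.
have := ler_pM (normr_ge0 _) (normr_ge0 _) h1 h2; lra.
Qed.

Lemma sin_lip x y : `|sin x - sin y| <= `|x - y|.
Proof.
have e z : sin z = cos (z - pi / 2) by rewrite cosBpihalf.
by rewrite !e (le_trans (cos_lip _ _))// opprB addrA subrK.
Qed.

(** From [1 - cos y = 2 sin^2 (y / 2)]. It recovers the square of the residual from its bounded
    cosines. *)
Lemma cvg_scaled_cos x : 2 * n.+1%:R ^+ 2 * (1 - cos (n.+1%:R^-1 * x)) @[n --> \oo] --> x ^+ 2.
Proof.
have h := @cvg_scaled_sin R (x / 2).
have h4 : 4 * (n.+1%:R * sin (n.+1%:R^-1 * (x / 2))) ^+ 2 @[n --> \oo] --> 4 * (x / 2) ^+ 2.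
  apply: cvgM; first exact: cvg_cst.
  apply: (cvg_comp (fun n => n.+1%:R * sin (n.+1%:R^-1 * (x / 2))) (fun y : R => y ^+ 2)).
    exact: h.
  exact: exprn_continuous.
rewrite (_ : x ^+ 2 = 4 * (x / 2) ^+ 2); last by field.
apply: cvg_trans h4; apply: near_eq_cvg; apply: nearW => n.
rewrite (_ : n.+1%:R^-1 * x = n.+1%:R^-1 * (x / 2) + n.+1%:R^-1 * (x / 2)); last by rewrite -mulrDr -splitr.
rewrite cosD -!expr2 cos2sin2; ring.
Qed.

Lemma scaled_cos_le (n : nat) x :
  `|2 * n.+1%:R ^+ 2 * (1 - cos (n.+1%:R^-1 * x))| <= x ^+ 2.
Proof.
rewrite (_ : n.+1%:R^-1 * x = n.+1%:R^-1 * (x / 2) + n.+1%:R^-1 * (x / 2)); last by rewrite -mulrDr -splitr.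
set y := n.+1%:R^-1 * (x / 2).
rewrite (_ : _ * _ = 4 * (n.+1%:R * sin y) ^+ 2); last by rewrite cosD -!expr2 cos2sin2; ring.
rewrite ger0_norm; last by apply: mulr_ge0 => //; exact: sqr_ge0.
have -> : x ^+ 2 = 4 * (n.+1%:R * y) ^+ 2.
  by rewrite /y mulrA divff ?pnatr_eq0// mul1r; field.
move: y => y; rewrite ler_wpM2l// !exprMn ler_wpM2l ?sqr_ge0//.
rewrite -[leLHS]real_normK ?num_real// -[leRHS]real_normK ?num_real//.
by rewrite ler_sqr ?nnegrE// norm_sin_le.
Qed.

Lemma scaled_sin_le (n : nat) x : `|n.+1%:R * sin (n.+1%:R^-1 * x)| <= `|x|.
Proof.
rewrite normrM (le_trans (ler_wpM2l _ (norm_sin_le _)))//.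
by rewrite -normrM mulrA divff ?mul1r.
Qed.

End trig_bounds.

(** * Moments along sequences converging fast in mean square *)

Section bounded_integrands.
Context d (T : measurableType d) (R : realType) (P : probability T R).
Implicit Types f g : T -> R.

Lemma integrable_bounded f (C : R) : measurable_fun setT f -> (forall w, `|f w| <= C) ->
  P.-integrable setT (EFin \o f).
Proof.
move=> mf fC; apply: (@le_integrableR _ _ _ P setT measurableT _ (fun=> C)) => //.
exact: finite_measure_integrable_cst.
Qed.

Lemma measurable_cos_comp f : measurable_fun setT f -> measurable_fun setT (fun w => cos (f w)).
Proof.
move=> mf; apply: (@measurableT_comp _ _ _ _ _ _ (@cos R)) => //.
exact: continuous_measurable_fun (@continuous_cos R).
Qed.

Lemma measurable_sin_comp f : measurable_fun setT f -> measurable_fun setT (fun w => sin (f w)).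
Proof.
move=> mf; apply: (@measurableT_comp _ _ _ _ _ _ (@sin R)) => //.
exact: continuous_measurable_fun (@continuous_sin R).
Qed.

Lemma integrable_cos f : measurable_fun setT f -> P.-integrable setT (EFin \o (fun w => cos (f w))).
Proof.
move=> mf; apply: (@integrable_bounded _ 1) => [|w]; first exact: measurable_cos_comp.
exact: cos_max.
Qed.

Lemma integrable_sin f : measurable_fun setT f -> P.-integrable setT (EFin \o (fun w => sin (f w))).
Proof.
move=> mf; apply: (@integrable_bounded _ 1) => [|w]; first exact: measurable_sin_comp.
exact: sin_max.
Qed.

Lemma cvg_Rintegral_lip (t : R -> R) (f : T -> R) (D : nat -> T -> R) :
  measurable_fun setT t -> (forall x, `|t x| <= 1) -> (forall x y, `|t x - t y| <= `|x - y|) ->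
  measurable_fun setT f -> (forall k, sq_integrable P (D k)) ->
  (forall k, \int[P]_w (D k w ^+ 2) <= (2^-1 ^+ k) ^+ 2) ->
  \int[P]_w t (f w - D k w) @[k --> \oo] --> \int[P]_w t (f w).
Proof.
move=> mt t1 tl mf sD D2.
have it g : measurable_fun setT g -> P.-integrable setT (EFin \o (fun w => t (g w))).
  by move=> mg; apply: (@integrable_bounded _ 1) => //; exact: measurableT_comp.
have mfD k : measurable_fun setT (fun w => f w - D k w).
  by apply: measurable_funB => //; exact: (sD k).1.
apply: cvg_zero; rewrite /=.
have lim0 : 2^-1 ^+ k @[k --> \oo] --> (0 : R).
  by apply: cvg_expr; rewrite ger0_norm ?invr_ge0// invf_lt1 ?ltr1n.
apply: norm_cvg0; apply: (@squeeze_cvgr _ _ _ _ (fun=> 0) _ _ _ _ _ lim0); last exact: cvg_cst.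
apply: nearW => k; rewrite normr_ge0/= !fctE -RintegralB//; [|exact: it..].
have iB := integrableRB measurableT (it _ (mfD k)) (it _ mf).
rewrite (le_trans (le_normr_Rintegral _ iB))//.
apply: (@le_trans _ _ (\int[P]_w `|D k w|)); last by apply: Rintegral_norm_le; rewrite ?exprn_gt0.
apply: le_Rintegral => //; first exact: integrable_norm.
  by apply: integrable_norm; exact: sq_integrable1.
by move=> w _; rewrite (le_trans (tl _ _))// addrAC subrr add0r normrN.
Qed.

Lemma cvg_Rintegral_sqr (f : T -> R) (D : nat -> T -> R) (a : R) :
  sq_integrable P f -> (forall k, sq_integrable P (D k)) ->
  (forall k, \int[P]_w (D k w ^+ 2) <= (2^-1 ^+ k) ^+ 2) ->
  \int[P]_w ((f w - a * D k w) ^+ 2) @[k --> \oo] --> \int[P]_w (f w ^+ 2).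
Proof.
move=> sf sD D2; set F := \int[P]_w (f w ^+ 2).
have lim0 : 2^-1 ^+ k @[k --> \oo] --> (0 : R).
  by apply: cvg_expr; rewrite ger0_norm ?invr_ge0// invf_lt1 ?ltr1n.
apply: cvg_zero; rewrite /=; apply: norm_cvg0.
have limC : (a ^+ 2 + `|a| * (F + 1)) * 2^-1 ^+ k @[k --> \oo] --> (0 : R).
  by rewrite -(mulr0 (a ^+ 2 + `|a| * (F + 1))); apply: cvgM => //; exact: cvg_cst.
apply: (@squeeze_cvgr _ _ _ _ (fun=> 0) _ _ _ _ _ limC); last exact: cvg_cst.
apply: nearW => k; rewrite normr_ge0/= !fctE.
rewrite (_ : (fun w => (f w - a * D k w) ^+ 2) = (fun w => (1 * f w + - a * D k w) ^+ 2)); last first.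
  by apply/funext => w; rewrite mul1r mulNr.
rewrite Rintegral_sqr_lin// -/F.
set e := 2^-1 ^+ k; have e0 : 0 < e by rewrite exprn_gt0.
have e1 : e <= 1 by rewrite exprn_ile1// ?invr_ge0// invf_le1 ?ler1n.
set q := \int[P]_w (D k w ^+ 2); set p := \int[P]_w (f w * D k w).
have q2 : q <= e ^+ 2 := D2 k.
have q0 : 0 <= q by apply: Rintegral_ge0 => w _; exact: sqr_ge0.
have F0 : 0 <= F by apply: Rintegral_ge0 => w _; exact: sqr_ge0.
(* Taken at [s = e] and [s = - e], with [q <= e^2], this bounds the cross term:
   [2 |p| <= e (F + 1)]. *)
have h (s : R) : 0 <= s ^+ 2 * F + q + 2 * s * p.
  have := Rintegral_sqr_lin s 1 sf (sD k).
  rewrite expr1n mul1r mulr1 => <-.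
  by apply: Rintegral_ge0 => w _; exact: sqr_ge0.
have pe : 2 * `|p| <= e * (F + 1).
  have hp := h e; have hm := h (- e).
  rewrite sqrrN in hm.
  suff : e * (2 * `|p|) <= e * (e * (F + 1)) by rewrite ler_pM2l.
  have [p0|p0] := leP 0 p; first by rewrite ger0_norm//; nra.
  by rewrite ltr0_norm//; nra.
rewrite expr1n mul1r mulr1 (_ : _ - F = a ^+ 2 * q - 2 * a * p); last by rewrite sqrrN; ring.
rewrite (le_trans (ler_normB _ _))//.
rewrite (_ : _ * e = a ^+ 2 * e + `|a| * (e * (F + 1))); last by ring.
apply: lerD.
  rewrite ger0_norm; last by apply: mulr_ge0 => //; exact: sqr_ge0.
  by rewrite ler_wpM2l ?sqr_ge0// (le_trans q2)// expr2 ler_piMl// ltW.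
by rewrite !normrM normr_nat [2 * _]mulrC -mulrA ler_wpM2l.
Qed.

End bounded_integrands.

(** * Gaussian projection *)

Section gaussian_projection.
Context d (T : measurableType d) (R : realType) (P : probability T R).
Variables (M : set (T -> R)) (G0 : set (set T)) (X : T -> R).
Hypothesis M0 : M (fun=> 0).
Hypothesis MB : forall f g, M f -> M g -> M (fun w => f w - g w).
Hypothesis MZ : forall (a : R) f, M f -> M (fun w => a * f w).
Hypothesis sM : forall f, M f -> sq_integrable P f.
Hypothesis sX : sq_integrable P X.
Hypothesis G0M : forall A, G0 A -> exists f B, [/\ M f, measurable B & A = f @^-1` B].
Hypothesis MG : forall f (B : set R), M f -> measurable B -> <<s G0 >> (f @^-1` B).
Hypothesis gcos : forall (a : R) f, M f ->
  \int[P]_w cos (a * X w + f w) = expR (- ((\int[P]_w ((a * X w + f w) ^+ 2)) / 2)).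
Hypothesis gsin : forall (a : R) f, M f -> \int[P]_w sin (a * X w + f w) = 0.

Let D : set R := [set \int[P]_w ((X w - f w) ^+ 2) | f in M].

Let D_ge0 x : D x -> 0 <= x.
Proof. by move=> [f _ <-]; apply: Rintegral_ge0 => w _; exact: sqr_ge0. Qed.

Let has_inf_D : has_inf D.
Proof.
split; first by exists (\int[P]_w ((X w - 0) ^+ 2)); exists (fun=> 0).
by exists 0 => x /D_ge0.
Qed.

Let dist := inf D.

Let dist_le f : M f -> dist <= \int[P]_w ((X w - f w) ^+ 2).
Proof. by move=> Mf; apply: ge_inf; [exact: has_inf_D.2|exists f]. Qed.

Let sXB f : M f -> sq_integrable P (fun w => X w - f w).
Proof. by move=> Mf; apply: sq_integrableB => //; exact: sM. Qed.

(** The parallelogram identity for [X - f] and [X - g]; the midpoint of [f] and [g] lies in [M], so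
    its error is at least [dist]. *)
Let parallelogram f g : M f -> M g ->
  \int[P]_w ((f w - g w) ^+ 2) <= 2 * (\int[P]_w ((X w - f w) ^+ 2) - dist)
    + 2 * (\int[P]_w ((X w - g w) ^+ 2) - dist).
Proof.
move=> Mf Mg; have sf := sXB Mf; have sg := sXB Mg.
have e1 : \int[P]_w ((f w - g w) ^+ 2) =
    \int[P]_w ((1 * (X w - f w) + -1 * (X w - g w)) ^+ 2).
  by apply: eq_Rintegral => w _; ring.
have Mfg : M (fun w => 2^-1 * f w - - 2^-1 * g w) by apply: MB; exact: MZ.
have := dist_le Mfg.
have -> : \int[P]_w ((X w - (2^-1 * f w - - 2^-1 * g w)) ^+ 2) =
    \int[P]_w ((2^-1 * (X w - f w) + 2^-1 * (X w - g w)) ^+ 2).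
  by apply: eq_Rintegral => w _; field.
rewrite e1 !Rintegral_sqr_lin//; lra.
Qed.

(** The quarter is chosen so that [parallelogram] yields exactly the Cauchy rate asked for by
    [sq_integrable_limit]. *)
Let minimizing : exists m : nat -> T -> R, (forall k, M (m k)) /\
  forall k, \int[P]_w ((X w - m k w) ^+ 2) <= dist + (2^-1 ^+ k) ^+ 2 / 4.
Proof.
have h (k : nat) : exists f, M f /\
    \int[P]_w ((X w - f w) ^+ 2) <= dist + (2^-1 ^+ k) ^+ 2 / 4.
  have e0 : 0 < (2^-1 ^+ k) ^+ 2 / 4 :> R by rewrite divr_gt0// !exprn_gt0// invr_gt0.
  have [_ [f Mf <-] lt] := inf_adherent e0 has_inf_D.
  by exists f; split=> //; exact: ltW.
by have [m hm] := choice h; exists m; split=> k; have [] := hm k.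
Qed.

Let sG : sigma_algebra setT <<s G0 >>.
Proof. exact: smallest_sigma_algebra. Qed.

Let Gm A : <<s G0 >> A -> measurable A.
Proof.
apply: smallest_sub; first exact: sigma_algebra_measurable.
move=> B /G0M[f [C [Mf mC ->]]]; rewrite -[_ @^-1` _]setTI.
exact: (sM Mf).1.
Qed.

(** [Y] is the limit of a minimizing sequence in [M] and [xi = X - Y] is orthogonal to [M]. The
    hypotheses [gcos] and [gsin] pass to the limit, and orthogonality factors the characteristic
    function of [l xi + f]. Hence [sin (l xi)] and the centered [cos (l xi)] integrate to [0] over
    the generated sigma-algebra; rescaling as [l] tends to [0] gives the statements on [xi] and
    [xi^2]. *)
Lemma gaussian_projection : exists (Y : T -> R) (v : R), [/\
  forall B : set R, measurable B -> <<s G0 >> (Y @^-1` B),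
  sq_integrable P Y,
  forall A, <<s G0 >> A -> \int[P]_(w in A) (X w - Y w) = 0,
  forall A, <<s G0 >> A -> \int[P]_(w in A) ((X w - Y w) ^+ 2) = v * fine (P A) &
  forall c, (forall f, M f -> c <= \int[P]_w ((X w - f w) ^+ 2)) -> c <= v].
Proof.
have [m [Mm hm]] := minimizing.
have e_le (k j : nat) : (k <= j)%N -> (2^-1 ^+ j) ^+ 2 <= (2^-1 ^+ k) ^+ 2 :> R.
  move=> kj; rewrite ler_sqr ?nnegrE ?exprn_ge0 ?invr_ge0//.
  by rewrite ler_wiXn2l ?invr_ge0// invf_le1 ?ler1n.
have cm (k j : nat) : (k <= j)%N -> \int[P]_w ((m k w - m j w) ^+ 2) <= (2^-1 ^+ k) ^+ 2.
  move=> kj; have := parallelogram (Mm k) (Mm j).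
  by have := hm k; have := hm j; have := e_le _ _ kj; lra.
have [Y [GY sY hY]] := @sq_integrable_limit _ _ _ P <<s G0 >> m sG Gm
  (fun k B => MG (Mm k)) (fun k => sM (Mm k)) cm.
pose xi w := X w - Y w; pose Dk k w := m k w - Y w.
have sxi : sq_integrable P xi by exact: sq_integrableB.
have sD k : sq_integrable P (Dk k) by apply: sq_integrableB => //; exact: sM.
(* [l xi + f] is approximated by [l X + (f - l m_k)], whose second summand is in [M], so [gcos] and
   [gsin] apply before the limit. *)
have lim_sqr (l : R) f : M f -> \int[P]_w ((l * X w + (f w - l * m k w)) ^+ 2) @[k --> \oo] -->
    \int[P]_w ((l * xi w + 1 * f w) ^+ 2).
  move=> Mf; have sS := sq_integrable_lin l 1 sxi (sM Mf).
  have := cvg_Rintegral_sqr l sS sD hY.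
  rewrite (_ : (fun k => _) = (fun k => \int[P]_w ((l * X w + (f w - l * m k w)) ^+ 2)))//.
  by apply/funext => k; apply: eq_Rintegral => w _; rewrite /xi /Dk; ring.
have Mfm (l : R) f k : M f -> M (fun w => f w - l * m k w).
  by move=> Mf; apply: MB => //; exact: MZ.
have norm_xi : \int[P]_w (xi w ^+ 2) = dist.
  have := lim_sqr 1 (fun=> 0) M0.
  rewrite (_ : (fun w => (1 * xi w + _) ^+ 2) = (fun w => xi w ^+ 2)); last first.
    by apply/funext => w; ring.
  have eX k : \int[P]_w ((1 * X w + (0 - 1 * m k w)) ^+ 2) = \int[P]_w ((X w - m k w) ^+ 2).
    by apply: eq_Rintegral => w _; ring.
  under eq_fun do rewrite eX.
  move=> lim1.
  have limd : dist + (2^-1 ^+ k) ^+ 2 / 4 @[k --> \oo] --> dist + 0 ^+ 2 / 4.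
    apply: cvgD; first exact: cvg_cst.
    apply: cvgM; last exact: cvg_cst.
    apply: (cvg_comp (fun k => 2^-1 ^+ k) (fun y : R => y ^+ 2)); last exact: exprn_continuous.
    by apply: cvg_expr; rewrite ger0_norm ?invr_ge0// invf_lt1 ?ltr1n.
  rewrite expr0n mul0r addr0 in limd.
  apply: (@cvg_unique _ (@Rhausdorff R) _ _ _ _ lim1).
  apply: (@squeeze_cvgr _ _ _ _ (fun=> dist) _ _ _ _ _ limd); last exact: cvg_cst.
  by apply: nearW => k; rewrite dist_le//= hm.
have orth f : M f -> \int[P]_w (xi w * f w) = 0.
  move=> Mf; set p := \int[P]_w _.
  have q0 : 0 <= \int[P]_w (f w ^+ 2) by apply: Rintegral_ge0 => w _; exact: sqr_ge0.
  set q := \int[P]_w (f w ^+ 2) in q0.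
  have h (t : R) : 0 <= t ^+ 2 * q + 2 * t * p.
    have := lim_sqr 1 (fun w => t * f w) (MZ t Mf).
    rewrite (_ : (fun w => (1 * xi w + _) ^+ 2) = (fun w => (1 * xi w + t * f w) ^+ 2)); last first.
      by apply/funext => w; ring.
    rewrite (Rintegral_sqr_lin 1 t sxi (sM Mf)) norm_xi -/p -/q => lim1.
    have : dist <= 1 ^+ 2 * dist + t ^+ 2 * q + 2 * 1 * t * p.
      apply: (cvgr_to_ge lim1); apply: nearW => k.
      rewrite (_ : (fun w => _) = (fun w => (X w - (1 * m k w - t * f w)) ^+ 2)).
        by apply: dist_le; apply: MB; exact: MZ.
      by apply/funext => w; ring.
    lra.
  apply/eqP/negP => /negP p0.
  (* The form [t^2 q + 2 t p] is negative here unless [p = 0]; [q + 1] keeps the quotient valid when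
     [q = 0]. *)
  have := h (- p / (q + 1)).
  have -> : (- p / (q + 1)) ^+ 2 * q + 2 * (- p / (q + 1)) * p =
     - (p ^+ 2 * (q + 2) / (q + 1) ^+ 2) by field; rewrite gt_eqF// ltr_wpDl.
  rewrite oppr_ge0 => h0.
  have : 0 < p ^+ 2 * (q + 2) / (q + 1) ^+ 2.
    apply: divr_gt0; last by rewrite exprn_gt0// ltr_wpDl.
    by apply: mulr_gt0; [rewrite exprn_even_gt0|rewrite ltr_wpDl].
  by rewrite ltNge h0.
have norm_lin (l : R) f : M f -> \int[P]_w ((l * xi w + 1 * f w) ^+ 2) =
    l ^+ 2 * dist + \int[P]_w (f w ^+ 2).
  move=> Mf; rewrite (Rintegral_sqr_lin l 1 sxi (sM Mf)) norm_xi (orth _ Mf).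
  by rewrite expr1n mul1r mulr0 addr0.
(* The bound [|l| <= 1] preserves the rate [2^-k] for [l * Dk k]; it holds for the values used
   later, [0] and [1 / (n + 1)]. *)
have lim_lip (t : R -> R) (l : R) f : M f -> `|l| <= 1 -> measurable_fun setT t ->
    (forall x, `|t x| <= 1) -> (forall x y, `|t x - t y| <= `|x - y|) ->
    \int[P]_w t (l * X w + (f w - l * m k w)) @[k --> \oo] --> \int[P]_w t (l * xi w + f w).
  move=> Mf l1 mt t1 tl.
  have mS : measurable_fun setT (fun w => l * xi w + f w).
    by apply: measurable_funD; [apply: measurable_funM => //; exact: sxi.1|exact: (sM Mf).1].
  have sDl k : sq_integrable P (fun w => l * Dk k w).
    have := sq_integrable_lin l 0 (sD k) (sD k).
    by rewrite (_ : (fun w => _) = (fun w => l * Dk k w))//; apply/funext => w; rewrite mul0r addr0.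
  have hl k : \int[P]_w ((l * Dk k w) ^+ 2) <= (2^-1 ^+ k) ^+ 2.
    under eq_Rintegral do rewrite exprMn.
    rewrite RintegralZl//; last exact: (sD k).2.
    rewrite (le_trans _ (hY k))// ler_piMl//; first by apply: Rintegral_ge0 => w _; exact: sqr_ge0.
    by rewrite -real_normK ?num_real// exprn_ile1.
  have := cvg_Rintegral_lip mt t1 tl mS sDl hl.
  rewrite (_ : (fun k => _) = (fun k => \int[P]_w t (l * X w + (f w - l * m k w))))//.
  by apply/funext => k; apply: eq_Rintegral => w _; congr t; rewrite /xi /Dk; ring.
have mcos : measurable_fun setT (@cos R) := continuous_measurable_fun (@continuous_cos R).
have msin : measurable_fun setT (@sin R) := continuous_measurable_fun (@continuous_sin R).
have xcos (l : R) f : M f -> `|l| <= 1 -> \int[P]_w cos (l * xi w + f w) =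
    expR (- (l ^+ 2 * dist / 2)) * expR (- ((\int[P]_w (f w ^+ 2)) / 2)).
  move=> Mf l1; have lim1 := lim_lip _ l f Mf l1 mcos (@cos_max R) (@cos_lip R).
  rewrite -expRD (_ : _ + _ = - ((\int[P]_w ((l * xi w + 1 * f w) ^+ 2)) / 2)); last first.
    by rewrite norm_lin//; ring.
  apply: (@cvg_unique _ (@Rhausdorff R) _ _ _ _ lim1).
  rewrite (_ : (fun k => _) = (fun k =>
      expR (- ((\int[P]_w ((l * X w + (f w - l * m k w)) ^+ 2)) / 2)))); last first.
    by apply/funext => k; apply: gcos; exact: Mfm.
  apply: (cvg_comp (fun k => - ((\int[P]_w ((l * X w + (f w - l * m k w)) ^+ 2)) / 2)) (@expR R)); last exact: continuous_expR.
  by apply: cvgN; apply: cvgM; [exact: lim_sqr|exact: cvg_cst].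
have xsin (l : R) f : M f -> `|l| <= 1 -> \int[P]_w sin (l * xi w + f w) = 0.
  move=> Mf l1; have lim1 := lim_lip _ l f Mf l1 msin (@sin_max R) (@sin_lip R).
  apply: (@cvg_unique _ (@Rhausdorff R) _ _ _ _ lim1).
  rewrite (_ : (fun k => _) = (fun=> 0)); first exact: cvg_cst.
  by apply/funext => k; apply: gsin; exact: Mfm.
have MN f : M f -> M (fun w => - f w).
  by move=> /(MB M0); rewrite (_ : (fun w => _) = (fun w => - f w))//; apply/funext => w; rewrite sub0r.
have mxi := sxi.1.
have mlin (l : R) f : M f -> measurable_fun setT (fun w => l * xi w + f w).
  by move=> Mf; apply: measurable_funD; [exact: measurable_funM|exact: (sM Mf).1].
have mlxi (l : R) : measurable_fun setT (fun w => l * xi w) by exact: measurable_funM.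
have sinA (l : R) A : `|l| <= 1 -> <<s G0 >> A -> \int[P]_(w in A) sin (l * xi w) = 0.
  move=> l1; apply: (@Rintegral_sigma_trig _ _ _ P M) => //.
  - by move=> f /sM[].
  - exact: integrable_sin.
  - move=> f Mf.
    rewrite (_ : (fun w => _) = (fun w => 2^-1 * (sin (l * xi w + f w) + sin (l * xi w + - f w)))); last first.
      by apply/funext => w; rewrite sinD sinB; field.
    have i1 := integrable_sin P (mlin l f Mf); have i2 := integrable_sin P (mlin l _ (MN _ Mf)).
    by rewrite RintegralZl ?RintegralD ?(xsin l f)// ?(xsin l (fun w => - f w)) ?addr0 ?mulr0//; [exact: MN|exact: integrableRD].
  - move=> f Mf.
    rewrite (_ : (fun w => _) = (fun w => 2^-1 * (cos (l * xi w + - f w) - cos (l * xi w + f w)))); last first.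
      by apply/funext => w; rewrite cosB cosD; field.
    have i1 := integrable_cos P (mlin l f Mf); have i2 := integrable_cos P (mlin l _ (MN _ Mf)).
    rewrite RintegralZl ?RintegralB//; last exact: integrableRB.
    rewrite (xcos l f)// (xcos l (fun w => - f w))//; last exact: MN.
    by under eq_Rintegral do rewrite sqrrN; rewrite subrr mulr0.
have e_ (l : R) f : M f -> \int[P]_w cos (f w) = expR (- ((\int[P]_w (f w ^+ 2)) / 2)).
  move=> Mf; have := xcos 0 f Mf; rewrite normr0 ler01 => /(_ isT).
  rewrite expr0n !mul0r oppr0 expR0 mul1r => <-.
  by apply: eq_Rintegral => w _; rewrite mul0r add0r.
have es f : M f -> \int[P]_w sin (f w) = 0.
  move=> Mf; have := xsin 0 f Mf; rewrite normr0 ler01 => /(_ isT) <-.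
  by apply: eq_Rintegral => w _; rewrite mul0r add0r.
(* The factorization [xcos] gives [E[cos (l xi) cos f] = el * E[cos f]], hence the subtraction of
   [el]. *)
have cosA (l : R) A : `|l| <= 1 -> <<s G0 >> A ->
    \int[P]_(w in A) (cos (l * xi w) - expR (- (l ^+ 2 * dist / 2))) = 0.
  move=> l1; set el := expR _.
  have iel : P.-integrable setT (EFin \o (fun=> el)) by exact: finite_measure_integrable_cst.
  apply: (@Rintegral_sigma_trig _ _ _ P M) => //.
  - by move=> f /sM[].
  - by apply: integrableRB => //; exact: integrable_cos.
  - move=> f Mf.
    rewrite (_ : (fun w => _) = (fun w => 2^-1 * (cos (l * xi w + f w) + cos (l * xi w + - f w)) - el * cos (f w))); last first.
      by apply/funext => w; rewrite cosB cosD; field.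
    have i1 := integrable_cos P (mlin l f Mf); have i2 := integrable_cos P (mlin l _ (MN _ Mf)).
    have i3 := integrable_cos P (sM Mf).1; have i12 := integrableRD measurableT i1 i2.
    rewrite RintegralB//; [|exact: integrableRZ|exact: integrableRZ].
    rewrite !RintegralZl// RintegralD// (xcos l f)// (xcos l (fun w => - f w))//; last exact: MN.
    under [X in _ + _ * expR (- (X / _))]eq_Rintegral do rewrite sqrrN.
    by rewrite (e_ l f)// -/el; field.
  - move=> f Mf.
    rewrite (_ : (fun w => _) = (fun w => 2^-1 * (sin (l * xi w + f w) - sin (l * xi w + - f w)) - el * sin (f w))); last first.
      by apply/funext => w; rewrite sinD sinB; field.
    have i1 := integrable_sin P (mlin l f Mf); have i2 := integrable_sin P (mlin l _ (MN _ Mf)).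
    have i3 := integrable_sin P (sM Mf).1; have i12 := integrableRB measurableT i1 i2.
    rewrite RintegralB//; [|exact: integrableRZ|exact: integrableRZ].
    rewrite !RintegralZl// RintegralB// (xsin l f)// (xsin l (fun w => - f w))//; last exact: MN.
    by rewrite (es f)//; ring.
have l1 (n : nat) : `|n.+1%:R^-1| <= 1 :> R.
  by rewrite ger0_norm ?invr_ge0// invf_le1 ?ler1n.
have dct (A : set T) (h : nat -> T -> R) (g G : T -> R) : measurable A ->
    (forall n, measurable_fun setT (h n)) -> P.-integrable setT (EFin \o G) ->
    measurable_fun setT g ->
    (forall n w, `|h n w| <= G w) -> (forall w, h n w @[n --> \oo] --> g w) ->
    \int[P]_(w in A) h n w @[n --> \oo] --> \int[P]_(w in A) g w.
  move=> mA mh iG mg hG hcv.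
  have iGA : P.-integrable A (EFin \o G) by apply: integrableS iG.
  have gG w : `|g w| <= G w.
    by apply: (cvgr_to_le (cvg_norm (hcv w))); apply: nearW => n; exact: hG.
  apply: fine_cvg; rewrite fineK; last first.
    apply: integrable_fin_num => //.
    by apply: (@le_integrableR _ _ _ P A mA g G) => //; exact: measurable_funTS.
  apply: (@dominated_cvg _ _ _ P A mA _ _ (EFin \o G)) => //.
  - by move=> n; apply/measurable_EFinP; exact: measurable_funTS.
  - by move=> w _; apply: cvg_EFin; [exact: nearW|exact: hcv].
  - by move=> n w _; rewrite /= lee_fin.
exists Y, dist; split => //.
- move=> A GA; have mA := Gm GA.
  have msn n : measurable_fun setT (fun w => n.+1%:R * sin (n.+1%:R^-1 * xi w)).
    by apply: measurable_funM => //; exact: measurable_sin_comp.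
  have lim1 : \int[P]_(w in A) (n.+1%:R * sin (n.+1%:R^-1 * xi w)) @[n --> \oo] -->
      \int[P]_(w in A) xi w.
    apply: (dct A (fun n w => n.+1%:R * sin (n.+1%:R^-1 * xi w)) xi (fun w => `|xi w|)) => //.
    - exact: integrable_norm (sq_integrable1 sxi).
    - by move=> n w; exact: scaled_sin_le.
    - by move=> w; exact: cvg_scaled_sin.
  apply: (@cvg_unique _ (@Rhausdorff R) _ _ _ _ lim1).
  rewrite (_ : (fun n => _) = (fun=> 0)); first exact: cvg_cst.
  apply/funext => n; rewrite RintegralZl//; first by rewrite sinA// mulr0.
  by apply: (integrableS measurableT) => //; exact: integrable_sin.
- pose cn (n : nat) := 2 * n.+1%:R ^+ 2 * (1 - expR (- (n.+1%:R^-1 ^+ 2 * dist / 2))).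
  have lim1 A : measurable A -> <<s G0 >> A ->
      cn n * fine (P A) @[n --> \oo] --> \int[P]_(w in A) (xi w ^+ 2).
    move=> mA GA.
    have mh n : measurable_fun setT (fun w => 2 * n.+1%:R ^+ 2 * (1 - cos (n.+1%:R^-1 * xi w))).
      by apply: measurable_funM => //; apply: measurable_funB => //; exact: measurable_cos_comp.
    have : \int[P]_(w in A) (2 * n.+1%:R ^+ 2 * (1 - cos (n.+1%:R^-1 * xi w))) @[n --> \oo] -->
        \int[P]_(w in A) (xi w ^+ 2).
      apply: (dct A (fun n w => 2 * n.+1%:R ^+ 2 * (1 - cos (n.+1%:R^-1 * xi w)))
        (fun w => xi w ^+ 2) (fun w => xi w ^+ 2)) => //.
      - exact: sxi.2.
      - exact: measurable_funX.
      - by move=> n w; exact: scaled_cos_le.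
      - by move=> w; exact: cvg_scaled_cos.
    rewrite (_ : (fun n => _) = (fun n => cn n * fine (P A)))//; apply/funext => n.
    have ic : P.-integrable A (EFin \o (fun w => cos (n.+1%:R^-1 * xi w))).
      by apply: (integrableS measurableT) => //; exact: integrable_cos.
    have icst (c : R) : P.-integrable A (EFin \o (fun=> c)) by exact: finite_measure_integrable_cst.
    rewrite RintegralZl//; last exact: integrableRB.
    have := cosA n.+1%:R^-1 A (l1 n) GA; rewrite !RintegralB// !Rintegral_cst// => /eqP.
    by rewrite subr_eq0 => /eqP ->; rewrite /cn; ring.
  (* The case of the whole space identifies the limit of [cn] with [dist], without a limit of
     exponentials. *)
  have cnd : cn n @[n --> \oo] --> dist.
    have GT : <<s G0 >> setT.
      by have [g0 gC _] := sG; have := gC _ g0; rewrite setD0.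
    have := lim1 setT measurableT GT; rewrite norm_xi.
    rewrite (_ : (fun n => _) = cn)//; apply/funext => n.
    by rewrite (_ : fine (P setT) = 1) ?mulr1//; exact: (congr1 fine (@probability_setT _ _ _ P)).
  move=> A GA; have mA := Gm GA.
  apply: (@cvg_unique _ (@Rhausdorff R) _ _ _ _ (lim1 A mA GA)).
  by apply: cvgM; [exact: cnd|exact: cvg_cst].
- move=> c hc; apply: lb_le_inf; first exact: has_inf_D.1.
  by move=> _ [f Mf <-]; exact: hc.
Qed.

End gaussian_projection.

(** * Conditional variance *)

Section conditional_expectation.
Context d (T : measurableType d) (R : realType) (P : probability T R).
Variable G : set (set T).
Hypothesis sG : sigma_algebra setT G.
Hypothesis Gm : forall A, G A -> measurable A.
Implicit Types X Y : T -> R.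

Lemma sub_measurable_fun Y :
  preimage_set_system setT Y measurable `<=` G ->
  @measurable_fun _ _ (g_sigma_algebraType G) R setT Y.
Proof.
move=> YG _ B mB; apply: sub_sigma_algebra; apply: YG; exists B => //.
Qed.

(** The sets where [Y1 - Y2] is positive or negative belong to [G], so the integral of [|Y1 - Y2|]
    is zero. *)
Lemma cond_exp_unique X Y1 Y2 : is_cond_exp P G X Y1 -> is_cond_exp P G X Y2 ->
  {ae P, forall w, Y1 w = Y2 w}.
Proof.
move=> [m1 i1 e1] [m2 i2 e2]; pose h w := Y1 w - Y2 w.
have ih : P.-integrable setT (EFin \o h) by exact: integrableRB.
have mhG : @measurable_fun _ _ (g_sigma_algebraType G) R setT h.
  by apply: measurable_funB; exact: sub_measurable_fun.
have Gh (B : set R) : measurable B -> G (h @^-1` B).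
  move=> mB; have := mhG measurableT B mB; rewrite setTI.
  by rewrite /measurable/= (sigma_algebra_id sG).
have h0 A : G A -> \int[P]_(w in A) h w = 0.
  move=> GA; have mA := Gm GA.
  have i1A : P.-integrable A (EFin \o Y1) by apply: integrableS i1.
  have i2A : P.-integrable A (EFin \o Y2) by apply: integrableS i2.
  by rewrite RintegralB// /Rintegral (e1 _ GA) (e2 _ GA) subrr.
have GA := Gh _ (measurable_itv `]0, +oo[); have GB := Gh _ (measurable_itv `]-oo, 0[).
set A := h @^-1` _ in GA; set B := h @^-1` _ in GB.
have iA : P.-integrable setT (EFin \o (h \_ A)).
  by rewrite -restrict_EFin; apply/(integrable_mkcond _ (Gm GA)); apply: integrableS ih => //; exact: Gm.
have iB : P.-integrable setT (EFin \o (h \_ B)).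
  by rewrite -restrict_EFin; apply/(integrable_mkcond _ (Gm GB)); apply: integrableS ih => //; exact: Gm.
have abs0 : \int[P]_w `|h w| = 0.
  rewrite (_ : (fun w => `|h w|) = (fun w => (h \_ A) w - (h \_ B) w)).
    by rewrite RintegralB// -!Rintegral_mkcond !h0// subrr.
  apply/funext => w; rewrite !patchE.
  have -> : (w \in A) = (0 < h w) by apply/idP/idP; rewrite inE /A/= in_itv/= andbT.
  have -> : (w \in B) = (h w < 0) by apply/idP/idP; rewrite inE /B/= in_itv/=.
  have [hw|hw|hw] := ltgtP (h w) 0.
  - by rewrite ltr0_norm//; exact/esym/sub0r.
  - by rewrite gtr0_norm//; exact/esym/subr0.
  - by rewrite hw normr0; exact/esym/subrr.
have mh : measurable_fun setT h by apply/measurable_EFinP; exact: measurable_int ih.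
have : (\int[P]_w `|(EFin \o h) w| = 0)%E.
  have in_ : P.-integrable setT (EFin \o (fun w => `|h w|)) by exact: integrable_norm.
  by rewrite -[LHS](fineK (integrable_fin_num measurableT in_)) [fine _]abs0.
move/(ae_eq_integral_abs P measurableT (measurable_int _ ih)).
apply: filterS => w /(_ Logic.I)[/eqP]; rewrite subr_eq0 => /eqP.
exact.
Qed.

Lemma cond_expP X : (exists Y, is_cond_exp P G X Y) ->
  is_cond_exp P G X (cond_exp P G X).
Proof. by move=> [Y hY]; apply: (@xgetPex _ (cst 0) [set Y | is_cond_exp P G X Y]); exists Y. Qed.

Lemma measurable_cond_exp X Y : is_cond_exp P G X Y -> measurable_fun setT Y.
Proof. by move=> [_ iY _]; apply/measurable_EFinP; exact: measurable_int iY. Qed.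

Lemma integral_eq_Rintegral (A : set T) (f g : T -> R) : measurable A ->
  P.-integrable A (EFin \o f) -> P.-integrable A (EFin \o g) ->
  \int[P]_(w in A) f w = \int[P]_(w in A) g w ->
  (\int[P]_(w in A) (f w)%:E = \int[P]_(w in A) (g w)%:E)%E.
Proof.
move=> mA fi gi e; rewrite -[LHS]fineK; last exact: integrable_fin_num.
rewrite -[RHS]fineK; last exact: integrable_fin_num.
by congr EFin.
Qed.

(** [cond_exp] is an arbitrary version and only almost surely equal to [Y]; the constant is
    therefore checked against the residual of that version, which has the same integrals. *)
Lemma cond_var_cst X Y (v : R) :
  (forall B : set R, measurable B -> G (Y @^-1` B)) ->
  sq_integrable P X -> sq_integrable P Y ->
  (forall A, G A -> \int[P]_(w in A) (X w - Y w) = 0) ->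
  (forall A, G A -> \int[P]_(w in A) ((X w - Y w) ^+ 2) = v * fine (P A)) ->
  {ae P, forall w, cond_var P G X w = v}.
Proof.
move=> GY sX sY e1 e2.
have sXY := sq_integrableB sX sY.
have iX := sq_integrable1 sX; have iY := sq_integrable1 sY.
have cY : is_cond_exp P G X Y.
  split=> //; first by move=> _ [B mB <-]; rewrite setTI; exact: GY.
  move=> A GA; have mA := Gm GA.
  have iXA : P.-integrable A (EFin \o X) by apply: integrableS iX.
  have iYA : P.-integrable A (EFin \o Y) by apply: integrableS iY.
  apply: integral_eq_Rintegral => //; apply/esym/eqP; rewrite -subr_eq0.
  by rewrite -RintegralB// e1.
have cce := cond_expP (ex_intro _ Y cY).
have ceY := cond_exp_unique cce cY.
set ce := cond_exp P G X in cce ceY.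
have mce := measurable_cond_exp cce.
have cv : is_cond_exp P G (fun w => (X w - ce w) ^+ 2) (fun=> v).
  split.
  - move=> _ [B mB <-]; rewrite setTI; have [g0 gC _] := sG.
    have [Bv|Bv] := pselect (B v).
      by rewrite (_ : _ @^-1` _ = setT `\` set0); [exact: gC|by rewrite setD0; apply/seteqP; split].
    by rewrite (_ : _ @^-1` _ = set0)//; apply/seteqP; split.
  - exact: finite_measure_integrable_cst.
  - move=> A GA; have mA := Gm GA.
    transitivity (\int[P]_(w in A) ((X w - Y w) ^+ 2)%:E)%E.
      apply: integral_eq_Rintegral => //.
      + exact: finite_measure_integrable_cst.
      + by apply: integrableS sXY.2.
      + by rewrite e2// Rintegral_cst.
    apply: ae_eq_integral => //.
    + by apply/measurable_EFinP/measurable_funTS; apply: measurable_funX; exact: sXY.1.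
    + apply/measurable_EFinP/measurable_funTS; apply: measurable_funX.
      by apply: measurable_funB => //; exact: sX.1.
    + by apply: filterS ceY => w ->.
have := cond_expP (ex_intro _ _ cv).
by move=> /cond_exp_unique /(_ cv).
Qed.

End conditional_expectation.

(** * Bifractional Brownian motion *)

Section bifractional.
Context d (T : measurableType d) (R : realType) (P : probability T R).
Variables (H K : R) (B : R -> {RV P >-> R}).
Hypothesis hB : bifractional_brownian_motion H K B.

(** Lists of coefficient-time pairs encode the linear span: sums are concatenations, and repeated
    times are allowed. *)
Definition comb (l : seq (R * R)) (w : T) : R := \sum_(p <- l) p.1 * B p.2 w.

Definition cov (s t : R) : R :=
  (2 `^ K)^-1 * ((t `^ (2 * H) + s `^ (2 * H)) `^ K - `|t - s| `^ (2 * H * K)).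

Lemma sq_integrable_bifractional s : 0 <= s -> sq_integrable P (B s).
Proof.
move=> s0; have [_ _ _ hc] := hB; split; first exact: measurable_funP.
apply/integrableP; split.
  by apply/measurable_EFinP; apply: measurable_funX; exact: measurable_funP.
have := hc s s s0 s0; rewrite unlock => e.
rewrite (eq_integral (fun w => (B s w * B s w)%:E)) ?e ?ltry// => w _.
by rewrite /= ger0_norm ?sqr_ge0.
Qed.

Lemma covariance_bifractional s t : 0 <= s -> 0 <= t ->
  \int[P]_w (B s w * B t w) = cov s t.
Proof.
by move=> s0 t0; have [_ _ _ hc] := hB; have := hc s t s0 t0; rewrite unlock /Rintegral => ->.
Qed.

Lemma measurable_comb l : measurable_fun setT (comb l).
Proof.
by apply: measurable_sum => p; apply: measurable_funM => //; exact: measurable_funP.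
Qed.

Lemma comb_cat l1 l2 : comb (l1 ++ l2) = (fun w => comb l1 w + comb l2 w).
Proof. by apply/funext => w; rewrite /comb big_cat. Qed.

Lemma comb_scale (a : R) l : comb [seq (a * p.1, p.2) | p <- l] = (fun w => a * comb l w).
Proof.
apply/funext => w; rewrite /comb big_map mulr_sumr.
by apply: eq_bigr => p _; rewrite mulrA.
Qed.

Lemma comb1 s : comb [:: (1, s)] = B s.
Proof. by apply/funext => w; rewrite /comb big_seq1 mul1r. Qed.

Definition nonneg_times (l : seq (R * R)) := forall p, p \in l -> 0 <= p.2.

Lemma combE l w : comb l w = \sum_(i < size l) (nth (0, 0) l i).1 * B (nth (0, 0) l i).2 w.
Proof. by rewrite /comb (big_nth (0, 0)) big_mkord. Qed.

Lemma sq_integrable_comb l : nonneg_times l -> sq_integrable P (comb l).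
Proof.
elim: l => [|p l ih] h.
  rewrite (_ : comb [::] = fun=> 0); first exact: sq_integrable_cst.
  by apply/funext => w; rewrite /comb big_nil.
have := sq_integrable_lin p.1 1 (sq_integrable_bifractional (h p (mem_head _ _))) (ih _).
rewrite (_ : (fun w => _) = comb (p :: l)).
  by apply => q ql; apply: h; rewrite in_cons ql orbT.
by apply/funext => w; rewrite /comb big_cons mul1r.
Qed.

Lemma Rintegral_sqr_comb l : nonneg_times l -> \int[P]_w (comb l w ^+ 2) =
  \sum_(i < size l) \sum_(j < size l) (nth (0, 0) l i).1 * (nth (0, 0) l j).1 *
    cov (nth (0, 0) l j).2 (nth (0, 0) l i).2.
Proof.
move=> hl; pose u (i : 'I_(size l)) := (nth (0, 0) l i).1; pose x (i : 'I_(size l)) := (nth (0, 0) l i).2.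
have x0 i : 0 <= x i by apply: hl; exact: mem_nth.
have iB i j : P.-integrable setT (EFin \o (fun w => B (x j) w * B (x i) w)).
  by apply: sq_integrableM; exact: sq_integrable_bifractional.
have iB' i j : P.-integrable setT (EFin \o (fun w => u i * u j * (B (x j) w * B (x i) w))).
  exact: integrableRZ.
rewrite (_ : (fun w => _) = (fun w => \sum_i \sum_j u i * u j * (B (x j) w * B (x i) w))); last first.
  apply/funext => w; rewrite combE expr2 mulr_suml; apply: eq_bigr => i _.
  by rewrite mulr_sumr; apply: eq_bigr => j _; rewrite /u /x; ring.
rewrite Rintegral_sum//; last by move=> i; exact: integrableR_sum.
apply: eq_bigr => i _; rewrite Rintegral_sum//; apply: eq_bigr => j _.
by rewrite RintegralZl// covariance_bifractional.
Qed.

Lemma Rintegral_comb l : nonneg_times l -> \int[P]_w comb l w = 0.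
Proof.
move=> hl; have [_ hm _ _] := hB.
elim: l hl => [|p l ih] hl.
  by rewrite (_ : comb [::] = fun=> 0) ?Rintegral_cst ?mul0r//; apply/funext => w; rewrite /comb big_nil.
have hl' : nonneg_times l by move=> q ql; apply: hl; rewrite in_cons ql orbT.
have p0 : 0 <= p.2 by apply: hl; exact: mem_head.
have ip := sq_integrable1 (sq_integrable_bifractional p0).
have il := sq_integrable1 (sq_integrable_comb hl').
rewrite (_ : comb (p :: l) = fun w => p.1 * B p.2 w + comb l w).
  rewrite RintegralD//; last exact: integrableRZ.
  rewrite ih// RintegralZl// addr0.
  by have := hm _ p0; rewrite unlock /Rintegral => ->; rewrite mulr0.
by apply/funext => w; rewrite /comb big_cons.
Qed.

Lemma gaussian_comb l : nonneg_times l -> gaussian_rv P (comb l).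
Proof.
move=> hl; have [hg _ _ _] := hB.
have := hg (size l) (fun i => (nth (0, 0) l i).2) (fun i => (nth (0, 0) l i).1) _.
rewrite (_ : (fun w => _) = comb l); last by apply/funext => w; rewrite combE.
by apply=> i; apply: hl; exact: mem_nth.
Qed.

Lemma Rintegral_cos_comb l : nonneg_times l ->
  \int[P]_w cos (comb l w) = expR (- ((\int[P]_w (comb l w ^+ 2)) / 2)).
Proof.
move=> hl; apply: gaussian_cos; [exact: measurable_comb|exact: gaussian_comb| |exact: Rintegral_comb].
exact: (sq_integrable_comb hl).2.
Qed.

Lemma Rintegral_sin_comb l : nonneg_times l -> \int[P]_w sin (comb l w) = 0.
Proof.
move=> hl; apply: gaussian_sin; [exact: measurable_comb|exact: gaussian_comb| |exact: Rintegral_comb].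
exact: (sq_integrable_comb hl).2.
Qed.

Lemma bifractional_prediction_error (hH : 0 < H < 1) (hK : 0 < K <= 1) :
  exists2 c : R, 0 < c & forall (t r : R) (l : seq (R * R)), 0 < r -> r <= t ->
    (forall p, p \in l -> r <= p.2 /\ r <= `|p.2 - t|) ->
    c * r `^ (2 * H * K) <= \int[P]_w ((B t w - comb l w) ^+ 2).
Proof.
have /andP[H0 H1] := hH.
have [||c c0 hc] := @bifractional_form_ge R (2 * H) _ _ K hK.
- by rewrite mulr_gt0.
- by rewrite -[ltRHS]mulr1 ltr_pM2l.
have k0 : 0 < (2 `^ K)^-1 :> R by rewrite invr_gt0 powR_gt0.
exists ((2 `^ K)^-1 * c); first exact: mulr_gt0.
move=> t r l r0 rt hl.
(* The error is itself a combination, with coefficient [1] at index [ord0], which carries the time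
   [t]. *)
pose l' := (1, t) :: [seq (-1 * p.1, p.2) | p <- l].
have hl' p : p \in l' -> r <= p.2.
  by rewrite in_cons => /predU1P[->//|/mapP[q /hl[q1 _] ->]].
have nl' : nonneg_times l' by move=> p /hl'; apply: le_trans; exact: ltW.
rewrite (_ : (fun w => _) = (fun w => comb l' w ^+ 2)); last first.
  apply/funext => w; rewrite /l' -cat1s comb_cat comb1 comb_scale; congr (_ ^+ 2); ring.
rewrite Rintegral_sqr_comb//.
pose x (i : 'I_(size l')) := (nth (0, 0) l' i).2.
pose u (i : 'I_(size l')) := (nth (0, 0) l' i).1.
have p1 i : r <= x i by apply: hl'; exact: mem_nth.
have p2 i : i != ord0 -> r <= `|x i - x ord0|.
  move=> i0; have : nth (0, 0) l' i \in [seq (-1 * p.1, p.2) | p <- l].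
    by case: i i0 => -[//|i] hi _ /=; exact: mem_nth.
  by rewrite /x => /mapP[q /hl[_ q2] ->].
rewrite -[leLHS]mulrA.
apply: (le_trans (ler_wpM2l (ltW k0) (hc _ x u ord0 r r0 p1 p2 erefl))).
rewrite mulr_sumr le_eqVlt; apply/orP; left; apply/eqP; apply: eq_bigr => i _.
rewrite mulr_sumr; apply: eq_bigr => j _; rewrite /cov -/(u i) -/(u j) -/(x i) -/(x j).
by rewrite mulrCA.
Qed.

(** Reduces conditioning on infinitely many times to finite predictors: [M] is their span, and a
    lower bound valid on [M] holds for the squared distance [v], which is the conditional
    variance. *)
Lemma bifractional_cond_var_ge (S : set R) (t c : R) :
  (forall s, S s -> 0 <= s) -> 0 <= t ->
  (forall l, (forall p, p \in l -> S p.2) ->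
    c <= \int[P]_w ((B t w - comb l w) ^+ 2)) ->
  {ae P, forall w, c <= cond_var P (sigma_family S (fun s => B s)) (B t) w}.
Proof.
move=> S0 t0 hc.
pose M := [set f | exists2 l, (forall p, p \in l -> S p.2) & f = comb l].
pose G0 := \bigcup_(s in S) preimage_set_system setT (B s) measurable.
have nn l : (forall p, p \in l -> S p.2) -> nonneg_times l by move=> h p /h /S0.
have mS s (C : set R) : S s -> measurable C -> <<s G0 >> (B s @^-1` C).
  move=> Ss mC; apply: sub_sigma_algebra; exists s => //.
  by exists C => //; rewrite setTI.
have G0M A : G0 A -> exists f C, [/\ M f, measurable C & A = f @^-1` C].
  move=> [s Ss [C mC <-]]; exists (B s : T -> R), C; split=> //; last by rewrite setTI.
  by exists [:: (1, s)]; [move=> p; rewrite inE => /eqP ->|rewrite comb1].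
have MG f (C : set R) : M f -> measurable C -> <<s G0 >> (f @^-1` C).
  move=> [l hl ->] mC.
  have h : @measurable_fun _ _ (g_sigma_algebraType G0) R setT (comb l).
    rewrite (_ : comb l = fun w => \sum_(i < size l) (nth (0, 0) l i).1 * B (nth (0, 0) l i).2 w); last first.
      by apply/funext => w; rewrite combE.
    apply: measurable_sum => i; apply: measurable_funM => // _ D mD.
    by rewrite setTI; apply: mS => //; apply: hl; exact: mem_nth.
  by have := h measurableT C mC; rewrite setTI.
have Mlin (x : R) f : M f -> exists2 l, nonneg_times l & comb l = (fun w => x * B t w + f w).
  move=> [l hl ->]; exists ((x, t) :: l).
    by move=> p; rewrite in_cons => /predU1P[->//|/hl /S0].
  by apply/funext => w; rewrite /comb big_cons.
have [|||||||||Y [v [GY sY e1 e2 cv]]] := @gaussian_projection _ _ _ P M G0 (B t).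
- by exists [::] => //; apply/funext => w; rewrite /comb big_nil.
- move=> f g [l1 h1 ->] [l2 h2 ->]; exists (l1 ++ [seq (-1 * p.1, p.2) | p <- l2]).
    by move=> p; rewrite mem_cat => /orP[/h1//|/mapP[q /h2 ? ->]].
  by rewrite comb_cat comb_scale; apply/funext => w; rewrite mulN1r.
- move=> x f [l h ->]; exists [seq (x * p.1, p.2) | p <- l]; last by rewrite comb_scale.
  by move=> p /mapP[q /h ? ->].
- by move=> f [l /nn h ->]; exact: sq_integrable_comb.
- exact: sq_integrable_bifractional.
- exact: G0M.
- exact: MG.
- by move=> x f /(Mlin x)[l hl e]; have := Rintegral_cos_comb hl; rewrite e.
- by move=> x f /(Mlin x)[l hl e]; have := Rintegral_sin_comb hl; rewrite e.
have G0m A : <<s G0 >> A -> measurable A.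
  apply: smallest_sub; first exact: sigma_algebra_measurable.
  by move=> _ [s _ [C mC <-]]; exact: measurable_funP.
have cv' : c <= v by apply: cv => f [l hl ->]; exact: hc.
apply: filterS (cond_var_cst (smallest_sigma_algebra _ _) G0m GY
  (sq_integrable_bifractional t0) sY e1 e2).
by move=> w ->.
Qed.

End bifractional.

Theorem proposition2p1 (d : measure_display) (T : measurableType d)
    (R : realType) (P : probability T R) (H K : R)
    (hH : 0 < H < 1) (hK : 0 < K <= 1)
    (B : R -> {RV P >-> R}) (hB : bifractional_brownian_motion H K B)
    (a b : R) (ha : 0 < a) (hab : a < b) :
  strongly_locally_nondeterministic P (fun t => B t) `[a, b]
    (fun r => r `^ (2 * H * K)).
Proof.
have [c c0 hc] := bifractional_prediction_error hB hH hK.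
(* With [r0 = a], the condition [r <= r0] makes every time of the interval at least [r]. *)
exists c, a; split=> // t r /=; rewrite in_itv/= => /andP[at_ _].
rewrite le_min => /and3P[r0 rt ra].
apply: (bifractional_cond_var_ge hB) => [s /=[]||l hl].
- by rewrite in_itv/= => /andP[/(le_trans (ltW ha))].
- exact: le_trans (ltW ha) at_.
apply: hc => // p /hl[]; rewrite /= in_itv/= => /andP[ap _] /andP[rp _].
by split=> //; exact: le_trans ap.
Qed.
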